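(* Let $K$ be the operator with finitely many bounded separated interactions described in the context, with $(\mu\times\nu)(X\times Y)>0$ and associated quantities $p,r,C,M_\ell$. Let $\boldsymbol N=(N_1,\dots,N_r)$ be a vector of positive integers, and let $d^{\Box}_{\boldsymbol N}$ be as defined in the context. For each $\ell\in\{1,\dots,r\}$ let $P_\ell$ be a complex polynomial of degree less than $N_\ell$ and define $$\delta_\ell:=\sup_{|t|\le M_\ell}|e^{it}-P_\ell(t)|,\qquad q_\ell:=\sup_{|t|\le M_\ell}|P_\ell(t)|.$$ For a permutation $\pi$ of $\{1,\dots,r\}$ put $$\Delta_\pi:=\sum_{j=1}^r\delta_{\pi(j)}\prod_{h<j}q_{\pi(h)},\qquad\Delta:=\min_\pi\Delta_\pi.$$ There is an operator $K^{\Box}_{\boldsymbol N,\boldsymbol P}$ of rank at most $d^{\Box}_{\boldsymbol N}$ such that $$\|K-K^{\Box}_{\boldsymbol N,\boldsymbol P}\|\le\|K-K^{\Box}_{\boldsymbol N,\boldsymbol P}\|_{\rm HS}\le C\Delta.$$ Since $q_\ell\le1+\delta_\ell$, one always has $$\Delta\le\prod_{\ell=1}^r(1+\delta_\ell)-1.$$ Moreover, there is an approximant of $K$ of rank at most $d^{\Box}_{\boldsymbol N}$ and error at most $$C\min\left\{1,\ \prod_{\ell=1}^r(1+\delta_\ell)-1\right\}.$$ If $K$ is a contraction, $0<\epsilon<1/2$, and this last quantity is at most $\sqrt\epsilon$, then $$\Lambda_\epsilon(K^*K)\le d^{\Box}_{\boldsymbol N}\le p\prod_{\ell=1}^rN_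\ell.$$
   Context: Let $(X,\mu)$ and $(Y,\nu)$ be $\sigma$-finite measure spaces and $p,r\ge1$ integers. Let $w_X,a_1,\dots,a_p$ be measurable on $X$ and $w_Y,b_1,\dots,b_p$ measurable on $Y$ with $w_Xa_q\in L^2(X)$, $w_Yb_q\in L^2(Y)$, and $\mathfrak a(x,y):=\sum_{q=1}^pa_q(x)b_q(y)$. Let $\phi,X_1,\dots,X_r:X\to\mathbb R$ and $\psi,Y_1,\dots,Y_r:Y\to\mathbb R$ be measurable, and $$(Kf)(y)=w_Y(y)\int_Xw_X(x)\,\mathfrak a(x,y)\exp\!\left(i\Bigl[\phi(x)+\psi(y)+\sum_{\ell=1}^rX_\ell(x)Y_\ell(y)\Bigr]\right)f(x)\,d\mu(x),\quad f\in L^2(X).$$ Fix real centers $\xi_\ell,\eta_\ell$; put $\widetilde X_\ell:=X_\ell-\xi_\ell$, $\widetilde Y_\ell:=Y_\ell-\eta_\ell$, assumed essentially bounded; $C:=\|w_X(x)w_Y(y)\mathfrak a(x,y)\|_{L^2(X\times Y)}<\infty$; $\phi_0:=\phi+\sum_\ell\eta_\ell X_\ell-\sum_\ell\xi_\ell\eta_\ell$, $\psi_0:=\psi+\sum_\ell\xi_\ell Y_\ell$. For each $\ell$ let $z_\ell(x,y):=\widetilde X_\ell(x)\widetilde Y_\ell(y)$ and $$M_\ell:=\tfrac12\left(\operatorname{ess\,sup}_{X\times Y}z_\ell-\operatorname{ess\,inf}_{X\times Y}z_\ell\right).$$ For $\boldsymbol N=(N_1,\dots,N_r)$ with all $N_\ell\ge1$,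 $$\mathcal U^{\Box}_{\boldsymbol N}:=\operatorname{span}\Bigl\{w_Xa_qe^{i\phi_0}\prod_\ell\widetilde X_\ell^{\nu_\ell}:1\le q\le p,\ 0\le\nu_\ell<N_\ell\Bigr\}\subset L^2(X),$$ $$\mathcal V^{\Box}_{\boldsymbol N}:=\operatorname{span}\Bigl\{w_Yb_qe^{i\psi_0}\prod_\ell\widetilde Y_\ell^{\nu_\ell}:1\le q\le p,\ 0\le\nu_\ell<N_\ell\Bigr\}\subset L^2(Y),$$ $d^{\Box}_{\boldsymbol N}:=\min\{\dim\mathcal U^{\Box}_{\boldsymbol N},\dim\mathcal V^{\Box}_{\boldsymbol N}\}$. $\|\cdot\|_{\rm HS}$ is the Hilbert--Schmidt norm; $\Lambda_\epsilon(S):=\operatorname{rank}\mathbf 1_{(\epsilon,1-\epsilon)}(S)$ for a positive contraction $S$. *)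

(* Defs.v *)
From HB Require Import structures.
From mathcomp Require Import all_boot all_order all_algebra perm complex.
From mathcomp Require Import all_classical all_reals all_analysis.
From mathcomp Require Import measurable_realfun ess_sup_inf.
Set Implicit Arguments.
Unset Strict Implicit.
Unset Printing Implicit Defensive.
Import Order.TTheory GRing.Theory Num.Theory.
Import numFieldNormedType.Exports.
Local Open Scope classical_set_scope.
Local Open Scope ring_scope.

(* The modulus of a complex number as an element of [R]; the [`|z|] of the
   [numDomainType] structure of [R[i]] lives in [R[i]]. *)
Notation cabs := ComplexField.Normc.normc.

Definition cexpi (R : realType) (t : R) : R[i] := Complex (cos t) (sin t).

Section complex_functions.
Context d (T : measurableType d) (R : realType).
Variable mu : {measure set T -> \bar R}.
Implicit Types f g : T -> R[i].

Definition cmeasurable f :=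
  measurable_fun setT (fun x => complex.Re (f x)) /\
  measurable_fun setT (fun x => complex.Im (f x)).

Definition cintegral f : R[i] :=
  Complex (\int[mu]_x complex.Re (f x))%R (\int[mu]_x complex.Im (f x))%R.

Definition L2norm f : \bar R := 'N[mu]_(2%:E)[EFin \o (fun x => cabs (f x))]%E.

Definition square_integrable f := cmeasurable f /\ (L2norm f < +oo)%E.

End complex_functions.

Section L2_closed.
Context d (T : measurableType d) (R : realType).
Variable mu : {measure set T -> \bar R}.
Implicit Types f g : T -> R[i].

Let cabs_ge0 (z : R[i]) : 0 <= cabs z.
Proof. by case: z => a b; exact: sqrtr_ge0. Qed.

Let measurable_cabs f : cmeasurable f -> measurable_fun setT (fun x => cabs (f x)).
Proof.
move=> [mr mi].
have -> : (fun x => cabs (f x)) =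
    Num.sqrt \o (fun x => complex.Re (f x) ^+ 2 + complex.Im (f x) ^+ 2).
  by apply/funext => x /=; case: (f x).
apply: measurableT_comp.
  exact: (continuous_measurable_fun (@sqrt_continuous R)).
by apply: measurable_funD; exact: measurable_funX.
Qed.

Let Lnorm2_le (u v : T -> R) : measurable_fun setT u -> measurable_fun setT v ->
  (forall x, 0 <= u x <= v x) ->
  ('N[mu]_(2%:E)[EFin \o u] <= 'N[mu]_(2%:E)[EFin \o v])%E.
Proof.
move=> mu_ mv uv; rewrite unlock.
apply: gt0_ler_poweR => //.
- by rewrite in_itv/= leey andbT integral_ge0 // => x _; exact: poweR_ge0.
- by rewrite in_itv/= leey andbT integral_ge0 // => x _; exact: poweR_ge0.
apply: ge0_le_integral => //.
- by move=> x _; exact: poweR_ge0.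
- apply/measurable_EFinP; apply: (measurableT_comp (measurable_powR 2)).
  exact: measurableT_comp.
- apply/measurable_EFinP; apply: (measurableT_comp (measurable_powR 2)).
  exact: measurableT_comp.
move=> x _ /=; have /andP[u0 le_uv] := uv x.
rewrite lee_fin ge0_ler_powR ?nnegrE//.
by rewrite !ger0_norm // (le_trans u0).
Qed.

Lemma square_integrable_submod (a : R[i]) f g :
  square_integrable mu f -> square_integrable mu g ->
  square_integrable mu (a *: f + g).
Proof.
move=> [mf Lf] [mg Lg].
have mh : cmeasurable (a *: f + g).
  case: mf mg => fr fi [gr gi]; case: a => ar ai; split.
    have -> : (fun x => complex.Re ((Complex ar ai *: f + g) x)) =
        (fun x => ar * complex.Re (f x) - ai * complex.Im (f x) + complex.Re (g x)).
      by apply/funext => x; rewrite !fctE; case: (f x) => ? ?; case: (g x).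
    apply: measurable_funD => //.
    by apply: measurable_funB; apply: measurable_funM.
  have -> : (fun x => complex.Im ((Complex ar ai *: f + g) x)) =
      (fun x => ar * complex.Im (f x) + ai * complex.Re (f x) + complex.Im (g x)).
    by apply/funext => x; rewrite !fctE; case: (f x) => ? ?; case: (g x).
  apply: measurable_funD => //.
  by apply: measurable_funD; apply: measurable_funM.
split=> //.
pose u x := cabs (f x) * cabs a; pose v x := cabs (g x).
have pu : u \in Lfun mu 2%:E.
  apply: (@Lfun_scale _ _ _ mu (fun x => cabs (f x))); first by rewrite ler1n.
  by apply/andP; split; rewrite inE //; exact: measurable_cabs.
have mu_ : measurable_fun setT u by move: pu => /andP[]; rewrite inE.
have mv : measurable_fun setT v by exact: measurable_cabs.
have uv : (L2norm mu (a *: f + g)%R <= 'N[mu]_(2%:E)[EFin \o (u \+ v)%R])%E.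
  apply: Lnorm2_le.
  - exact: measurable_cabs.
  - exact: measurable_funD.
  move=> x; rewrite cabs_ge0/= /u /v mulrC -ComplexField.Normc.normcM.
  exact: le_normcD.
apply: (le_lt_trans uv).
apply: le_lt_trans (eminkowski mu mu_ mv _) _; first by rewrite lee_fin ler1n.
by rewrite lte_add_pinfty //; move: pu => /andP[_]; rewrite inE.
Qed.

Lemma square_integrable0 : square_integrable mu (0 : T -> R[i]).
Proof.
split; first by split; exact: measurable_cst.
rewrite /L2norm (_ : EFin \o _ = cst 0%E); first by rewrite Lnorm0 // eqe pnatr_eq0.
by apply/funext => x /=; rewrite expr0n/= addr0 sqrtr0.
Qed.

Definition square_integrable_pred : {pred T -> R[i]} :=
  [pred f | `[< square_integrable mu f >]].

Lemma square_integrable_submod_closed : submod_closed square_integrable_pred.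
Proof.
split; first exact: asboolT square_integrable0.
move=> a f g /asboolP Lf /asboolP Lg; apply: asboolT.
exact: square_integrable_submod.
Qed.

HB.instance Definition _ :=
  GRing.isSubmodClosed.Build _ _ square_integrable_pred
    square_integrable_submod_closed.

End L2_closed.

Record L2fun d (T : measurableType d) (R : realType)
    (mu : {measure set T -> \bar R}) := MkL2fun {
  L2fun_val : T -> R[i] ;
  L2fun_valP : L2fun_val \in square_integrable_pred mu }.

Section L2_space.
Context d (T : measurableType d) (R : realType).
Variable mu : {measure set T -> \bar R}.

HB.instance Definition _ := [isSub for @L2fun_val d T R mu].
HB.instance Definition _ := [Choice of L2fun mu by <:].
HB.instance Definition _ := [SubChoice_isSubLmodule of L2fun mu by <:].

Definition L2_eqv (f g : L2fun mu) : bool := `[< val f = val g %[ae mu] >].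

Let L2_eqv_refl : reflexive L2_eqv.
Proof. by move=> f; apply/asboolP; exact: aeW. Qed.

Let L2_eqv_sym : symmetric L2_eqv.
Proof. by move=> f g; apply/idP/idP => /asboolP h; apply/asboolP/ae_eq_sym. Qed.

Let L2_eqv_trans : transitive L2_eqv.
Proof.
by move=> f g h /asboolP gf /asboolP fh; apply/asboolP/(ae_eq_trans gf fh).
Qed.

Canonical L2_eqv_canonical :=
  EquivRel L2_eqv L2_eqv_refl L2_eqv_sym L2_eqv_trans.

Local Open Scope quotient_scope.

(* The complex Hilbert space L^2(mu), i.e. square-integrable functions up to
   almost everywhere equality. *)
Definition L2 : Type := {eq_quot L2_eqv}.
HB.instance Definition _ := Choice.on L2.
HB.instance Definition _ := EqQuotient.on L2.

Definition L2_add (u v : L2) : L2 := \pi_L2 (repr u + repr v).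
Definition L2_opp (u : L2) : L2 := \pi_L2 (- repr u).
Definition L2_scale (a : R[i]) (u : L2) : L2 := \pi_L2 (a *: repr u).

Let eqL2P (f g : L2fun mu) : reflect (val f = val g %[ae mu])
  (\pi_L2 f == \pi_L2 g).
Proof. by apply: (iffP idP); rewrite eqmodE => /asboolP. Qed.

Let reprL2 (f : L2fun mu) : val (repr (\pi_L2 f)) = val f %[ae mu].
Proof. by apply/eqL2P; rewrite reprK. Qed.

Let piD f g : L2_add (\pi_L2 f) (\pi_L2 g) = \pi_L2 (f + g).
Proof.
apply/eqP/eqL2P; move: (reprL2 f) (reprL2 g); apply: filterS2 => x hf hg _.
by rewrite !raddfD /= !fctE hf // hg.
Qed.

Let piN f : L2_opp (\pi_L2 f) = \pi_L2 (- f).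
Proof.
apply/eqP/eqL2P; move: (reprL2 f); apply: filterS => x hf _.
by rewrite !raddfN /= !fctE hf.
Qed.

Let piZ a f : L2_scale a (\pi_L2 f) = \pi_L2 (a *: f).
Proof.
apply/eqP/eqL2P; move: (reprL2 f); apply: filterS => x hf _.
by rewrite !linearZ /= !fctE hf.
Qed.

Let L2_addA : associative L2_add.
Proof.
elim/quotW => f; elim/quotW => g; elim/quotW => h.
by rewrite (piD g h) (piD f) (piD f g) (piD _ h) addrA.
Qed.

Let L2_addC : commutative L2_add.
Proof.
by elim/quotW => f; elim/quotW => g; rewrite (piD f g) (piD g f) addrC.
Qed.

Let L2_add0 : left_id (\pi_L2 0) L2_add.
Proof. by elim/quotW => f; rewrite (piD 0 f) add0r. Qed.

Let L2_addN : left_inverse (\pi_L2 0) L2_opp L2_add.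
Proof. by elim/quotW => f; rewrite (piN f) (piD (- f) f) addNr. Qed.

HB.instance Definition _ :=
  GRing.isZmodule.Build L2 L2_addA L2_addC L2_add0 L2_addN.

Let L2_scaleA a b u : L2_scale a (L2_scale b u) = L2_scale (a * b) u.
Proof.
by elim/quotW: u => f; rewrite (piZ b f) (piZ a (b *: f)) (piZ _ f) scalerA.
Qed.

Let L2_scale1 : left_id 1 L2_scale.
Proof. by elim/quotW => f; rewrite (piZ 1 f) scale1r. Qed.

Let L2_scaleDr : right_distributive L2_scale +%R.
Proof.
move=> a; elim/quotW => f; elim/quotW => g.
by rewrite [_ + _](piD f g) (piZ a f) (piZ a g) (piZ a (f + g)) [RHS]piD scalerDr.
Qed.

Let L2_scaleDl u : {morph L2_scale^~ u : a b / a + b}.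
Proof.
elim/quotW: u => f a b.
by rewrite (piZ a f) (piZ b f) (piZ (a + b) f) [RHS]piD scalerDl.
Qed.

HB.instance Definition _ := GRing.Zmodule_isLmodule.Build R[i] L2
  L2_scaleA L2_scale1 L2_scaleDr L2_scaleDl.

Definition L2_fun (u : L2) : T -> R[i] := val (repr u).

(* The class of [f] in L^2(mu) (and 0 if [f] is not square-integrable). *)
Definition toL2 (f : T -> R[i]) : L2 := \pi_L2 (insubd (0 : L2fun mu) f).

Lemma toL2K f : square_integrable mu f -> L2_fun (toL2 f) = f %[ae mu].
Proof.
move=> Lf; have If : f \in square_integrable_pred mu by exact: asboolT Lf.
by have := reprL2 (insubd 0 f); rewrite insubdK.
Qed.

End L2_space.

Coercion L2_fun : L2 >-> Funclass.
Arguments toL2 {d T R} mu f.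

Section linear_algebra.
Context (R : realType) (V : lmodType R[i]).

Definition lspan (A : set V) : set V :=
  [set v | exists n (c : 'I_n -> R[i]) (u : 'I_n -> V),
     (forall i, A (u i)) /\ v = \sum_i c i *: u i].

Definition lin_indep n (u : 'I_n -> V) :=
  forall c : 'I_n -> R[i], \sum_i c i *: u i = 0 -> forall i, c i = 0.

(* The dimension of a linear subspace, in {0, 1, 2, ...} U {+oo}. *)
Definition ldim (U : set V) : \bar R :=
  ereal_sup [set n%:R%:E | n in
    [set n | exists u : 'I_n -> V, (forall i, U (u i)) /\ lin_indep u]].

End linear_algebra.

Definition oprank (R : realType) (U V : lmodType R[i]) (F : U -> V) : \bar R :=
  ldim (range F).

Section hilbert.
Context d (T : measurableType d) (R : realType).
Variable mu : {measure set T -> \bar R}.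

Definition inner (u v : L2 mu) : R[i] :=
  cintegral mu (fun x => u x * conjc (v x)).

Definition orthonormal (B : set (L2 mu)) :=
  forall e f, B e -> B f -> inner e f = (e == f)%:R.

Definition orthonormal_basis (B : set (L2 mu)) :=
  orthonormal B /\ forall u, (forall e, B e -> inner u e = 0) -> u = 0.

Definition orth_projection (P : L2 mu -> L2 mu) :=
  [/\ linear P, forall u, P (P u) = P u &
      forall u v, inner (P u) v = inner u (P v)].

(* [E] is a projection-valued measure on the Borel sets of the real line with
   S = \int t dE(t).  The measure [m] below is the scalar spectral measure
   A |-> <E(A) u, u>; its existence expresses the sigma-additivity of [E]. *)
Definition spectral_measure (S : L2 mu -> L2 mu)
    (E : set (measurableTypeR R) -> L2 mu -> L2 mu) :=
  [/\ forall A, measurable A -> orth_projection (E A),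
      forall u, E setT u = u,
      forall A B, measurable A -> measurable B ->
        forall u, E (A `&` B) u = E A (E B u) &
      forall u, exists m : {measure set (measurableTypeR R) -> \bar R},
        [/\ forall A, measurable A ->
              m A = (complex.Re (inner (E A u) u))%:E,
            m.-integrable setT (fun t => t%:E) &
            inner (S u) u = Complex (\int[m]_t t)%R 0]].

(* The spectral projection 1_A(S) of a bounded self-adjoint operator [S], whose
   spectral measure exists and is unique by the spectral theorem. *)
Definition spectral_projection (S : L2 mu -> L2 mu)
    (A : set (measurableTypeR R)) : L2 mu -> L2 mu :=
  xget (fun=> 0) [set P | exists2 E, spectral_measure S E & P = E A].

Definition Lambda (eps : R) (S : L2 mu -> L2 mu) : \bar R :=
  oprank (spectral_projection S `]eps, (1 - eps)[).

End hilbert.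

Section operators.
Context d1 d2 (X : measurableType d1) (Y : measurableType d2) (R : realType).
Variables (mu : {measure set X -> \bar R}) (nu : {measure set Y -> \bar R}).

Definition opnorm (F : L2 mu -> L2 nu) : \bar R :=
  ereal_sup [set L2norm nu (F u) | u in [set u : L2 mu | (L2norm mu u <= 1)%E]].

(* The sum of the |F e|^2 does not depend on the orthonormal basis; the supremum
   only picks this common value. *)
Definition HSnorm (F : L2 mu -> L2 nu) : \bar R :=
  (ereal_sup [set (\esum_(e in B) (L2norm nu (F e) `^ 2)%E)%R |
     B in orthonormal_basis (mu := mu)] `^ 2^-1)%E.

(* The adjoint of a bounded operator exists and is unique. *)
Definition adjoint (F : L2 mu -> L2 nu) : L2 nu -> L2 mu :=
  xget (fun=> 0) [set G | forall u v, inner (F u) v = inner u (G v)].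

End operators.

Section separated_interactions.
Context d1 d2 (X : measurableType d1) (Y : measurableType d2) (R : realType).
Variables (mu : {measure set X -> \bar R}) (nu : {measure set Y -> \bar R}).
Variables (p r : nat).
Variables (wX : X -> R[i]) (a : 'I_p -> X -> R[i]).
Variables (wY : Y -> R[i]) (b : 'I_p -> Y -> R[i]).

Definition amplitude (x : X) (y : Y) : R[i] := \sum_q a q x * b q y.

Definition interaction_op (phi : X -> R) (psi : Y -> R)
    (Xs : 'I_r -> X -> R) (Ys : 'I_r -> Y -> R) (f : L2 mu) : L2 nu :=
  toL2 nu (fun y => wY y * cintegral mu (fun x =>
    wX x * amplitude x y *
    cexpi (phi x + psi y + \sum_l Xs l x * Ys l y) * f x)).

End separated_interactions.

(* The span of w a_q e^{i phi0} \prod_l Z_l^{k_l}, for all q and all k_l < N_l *)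
Definition box_space d (T : measurableType d) (R : realType)
    (mu : {measure set T -> \bar R}) (p r : nat) (N : 'I_r -> nat)
    (w : T -> R[i]) (a : 'I_p -> T -> R[i]) (phi0 : T -> R)
    (Z : 'I_r -> T -> R) : set (L2 mu) :=
  lspan [set u | exists (q : 'I_p) (k : 'I_r -> nat),
    (forall l, (k l < N l)%N) /\
    u = toL2 mu (fun x =>
      w x * a q x * cexpi (phi0 x) * (\prod_l Z l x ^+ k l)%:C%C)].
Arguments box_space {d T R} mu {p r} N w a phi0 Z.

(* Main.v *)
(** The phase is X_l Y_l = z_l up to terms in x alone or y alone, and z_l stays
    within M_l of its essential midpoint c_l; so e^{i z_l} is within delta_l of
    e^{i c_l} P_l(z_l - c_l), a polynomial in z_l of degree < N_l.  A telescoping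
    product turns this into a pointwise bound Delta on the error of the kernel,
    relative to |w_X w_Y a|, hence a Hilbert-Schmidt bound C Delta (Bessel's
    inequality in almost every slice).  Expanding the product of polynomials in
    z_l = X_l Y_l separates the variables, which bounds the rank of the
    approximant K' by both dimensions.  If |K - K'| <= sqrt eps, then K' is
    injective on the range of the spectral projection of K*K onto ]eps, 1 - eps[,
    since there |K u|^2 = <K*K u, u> > eps |u|^2. *)

Require Import Defs.
From HB Require Import structures.
From mathcomp Require Import all_boot all_order all_algebra perm complex.
From mathcomp Require Import all_classical all_reals all_analysis.
From mathcomp Require Import finmap measurable_realfun ess_sup_inf.
From mathcomp Require Import ring lra.
Set Implicit Arguments.
Unset Strict Implicit.
Unset Printing Implicit Defensive.
Import Order.TTheory GRing.Theory Num.Theory.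
Import numFieldNormedType.Exports.
Local Open Scope classical_set_scope.
Local Open Scope ring_scope.

(** * Complex-valued functions and L^2 *)

(** The approximating kernel is a product of [r] factors and does not depend on the order in which
    they replace the exact ones. A permutation enters only through the telescoping estimate, so a
    single operator satisfies every bound [Delta_ s] and hence the smallest.

    The Hilbert-Schmidt bound and the spectral count rest on one datum, the L^2 norm of the error
    kernel: Bessel controls finite orthonormal families, Cauchy-Schwarz a single vector. The
    obstacle is that elements of L^2 are classes and that the slices of a kernel are
    square-integrable only for almost every [y]; every identity between operators is therefore
    proved on good slices and then passed to classes.

    Of the two rank bounds, the one by the space over Y is visible in the range. The space over X
    enters through the functionals that pair [u] with its generators: a basis of their span already
    determines the value of the operator at [u]. *)

Section complex_modulus.
Context (R : realType).
Implicit Types (z w : R[i]) (t : R).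

Lemma cabs_ge0 z : 0 <= cabs z.
Proof. by case: z => a b; exact: sqrtr_ge0. Qed.

Lemma cabs_sqr z : cabs z ^+ 2 = complex.Re z ^+ 2 + complex.Im z ^+ 2.
Proof. by case: z => a b /=; rewrite sqr_sqrtr // addr_ge0 // sqr_ge0. Qed.

Lemma cabsM z w : cabs (z * w) = cabs z * cabs w.
Proof. exact: ComplexField.Normc.normcM. Qed.

Lemma cabsJ z : cabs (conjc z) = cabs z.
Proof. by case: z => a b /=; rewrite sqrrN. Qed.

Lemma cabsN z : cabs (- z) = cabs z.
Proof. by case: z => a b /=; rewrite !sqrrN. Qed.

Lemma cabs_real t : cabs t%:C%C = `|t|.
Proof. by rewrite /= expr0n /= addr0 sqrtr_sqr. Qed.

Lemma cabs0 : cabs (0 : R[i]) = 0.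
Proof. by rewrite (cabs_real 0) normr0. Qed.

Lemma cabs1 : cabs (1 : R[i]) = 1.
Proof. by rewrite (cabs_real 1) normr1. Qed.

Lemma cabs_eq0 z : cabs z = 0 -> z = 0.
Proof. exact: ComplexField.Normc.eq0_normc. Qed.

Lemma cabs_prod (I : Type) (s : seq I) (P : pred I) (F : I -> R[i]) :
  cabs (\prod_(i <- s | P i) F i) = \prod_(i <- s | P i) cabs (F i).
Proof. by elim/big_rec2: _ => [|i y x _ <-]; rewrite ?cabs1 // cabsM. Qed.

Lemma ler_cabsD z w : cabs (z + w) <= cabs z + cabs w.
Proof. exact: le_normcD. Qed.

Lemma ler_cabs_sum (I : Type) (s : seq I) (P : pred I) (F : I -> R[i]) :
  cabs (\sum_(i <- s | P i) F i) <= \sum_(i <- s | P i) cabs (F i).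
Proof.
elim/big_rec2: _ => [|i y x _ yx]; first by rewrite cabs0.
by rewrite (le_trans (ler_cabsD _ _)) // lerD2l.
Qed.

Lemma ler_normRe_cabs z : `|complex.Re z| <= cabs z.
Proof.
rewrite -(ler_pXn2r (n := 2)) ?nnegrE ?cabs_ge0 //.
by rewrite cabs_sqr real_normK ?num_real // lerDl sqr_ge0.
Qed.

Lemma ler_normIm_cabs z : `|complex.Im z| <= cabs z.
Proof.
rewrite -(ler_pXn2r (n := 2)) ?nnegrE ?cabs_ge0 //.
by rewrite cabs_sqr real_normK ?num_real // lerDr sqr_ge0.
Qed.

Lemma mulcJ z : z * conjc z = (cabs z ^+ 2)%:C%C.
Proof.
rewrite cabs_sqr; case: z => a b; apply/eqP; rewrite eq_complex /=.
by apply/andP; split; apply/eqP; ring.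
Qed.

Lemma complexRI (s t : R) : s%:C%C = t%:C%C -> s = t.
Proof. by case. Qed.

Lemma cexpiD (s t : R) : cexpi (s + t) = cexpi s * cexpi t.
Proof.
rewrite /cexpi cosD sinD; apply/eqP; rewrite eq_complex /=.
by apply/andP; split; apply/eqP; ring.
Qed.

Lemma cexpi0 : cexpi 0 = 1 :> R[i].
Proof. by rewrite /cexpi cos0 sin0. Qed.

Lemma cexpi_sum (I : Type) (s : seq I) (P : pred I) (F : I -> R) :
  cexpi (\sum_(i <- s | P i) F i) = \prod_(i <- s | P i) cexpi (F i).
Proof. by elim/big_rec2: _ => [|i y x _ <-]; rewrite ?cexpi0 // cexpiD. Qed.

Lemma cabs_cexpi t : cabs (cexpi t) = 1.
Proof. by rewrite /= cos2Dsin2 sqrtr1. Qed.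

End complex_modulus.

Section complex_measurability.
Context d (T : measurableType d) (R : realType).
Implicit Types (f g : T -> R[i]) (h : T -> R).

Lemma cmeasurable_cst (c : R[i]) : cmeasurable (fun _ : T => c).
Proof. by split; exact: measurable_cst. Qed.

Lemma cmeasurableD f g :
  cmeasurable f -> cmeasurable g -> cmeasurable (fun x => f x + g x).
Proof.
move=> [fr fi] [gr gi]; split.
  rewrite (_ : (fun _ => _) = fun x => complex.Re (f x) + complex.Re (g x)).
    exact: measurable_funD.
  by apply/funext => x; case: (f x); case: (g x).
rewrite (_ : (fun _ => _) = fun x => complex.Im (f x) + complex.Im (g x)).
  exact: measurable_funD.
by apply/funext => x; case: (f x); case: (g x).
Qed.

Lemma cmeasurableM f g :
  cmeasurable f -> cmeasurable g -> cmeasurable (fun x => f x * g x).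
Proof.
move=> [fr fi] [gr gi]; split.
  rewrite (_ : (fun _ => _) = fun x => complex.Re (f x) * complex.Re (g x)
    - complex.Im (f x) * complex.Im (g x)).
    by apply: measurable_funB; exact: measurable_funM.
  by apply/funext => x; case: (f x); case: (g x).
rewrite (_ : (fun _ => _) = fun x => complex.Re (f x) * complex.Im (g x)
    + complex.Im (f x) * complex.Re (g x)).
  by apply: measurable_funD; exact: measurable_funM.
by apply/funext => x; case: (f x); case: (g x).
Qed.

Lemma cmeasurable_sum (I : Type) (s : seq I) (P : pred I) (F : I -> T -> R[i]) :
  (forall i, cmeasurable (F i)) -> cmeasurable (fun x => \sum_(i <- s | P i) F i x).
Proof.
move=> mF; elim: s => [|i s ih].
  by under eq_fun do rewrite big_nil; exact: cmeasurable_cst.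
under eq_fun do rewrite big_cons.
by case: (P i) => //; exact: cmeasurableD.
Qed.

Lemma cmeasurable_real h :
  measurable_fun setT h -> cmeasurable (fun x => (h x)%:C%C).
Proof. by move=> mh; split => //; exact: measurable_cst. Qed.

Lemma cmeasurableJ f : cmeasurable f -> cmeasurable (fun x => conjc (f x)).
Proof.
move=> [fr fi]; split.
  rewrite (_ : (fun _ => _) = (fun x => complex.Re (f x))) //.
  by apply/funext => x /=; case: (f x).
rewrite (_ : (fun _ => _) = fun x => - complex.Im (f x)).
  exact: measurableT_comp.
by apply/funext => x; case: (f x).
Qed.

Lemma cmeasurable_cexpi h :
  measurable_fun setT h -> cmeasurable (fun x => cexpi (h x)).
Proof.
move=> mh; split; rewrite /cexpi /=.
  apply: (measurableT_comp (f := @cos R)) => //.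
  by apply: continuous_measurable_fun; exact: continuous_cos.
apply: (measurableT_comp (f := @sin R)) => //.
by apply: continuous_measurable_fun; exact: continuous_sin.
Qed.

Lemma measurable_cabs f :
  cmeasurable f -> measurable_fun setT (fun x => cabs (f x)).
Proof.
move=> [mr mi].
rewrite (_ : (fun _ => _) =
    Num.sqrt \o (fun x => complex.Re (f x) ^+ 2 + complex.Im (f x) ^+ 2)).
  apply: measurableT_comp.
    exact: (continuous_measurable_fun (@sqrt_continuous R)).
  by apply: measurable_funD; exact: measurable_funX.
by apply/funext => x /=; case: (f x).
Qed.

Lemma measurable_cabs2 f :
  cmeasurable f -> measurable_fun setT (fun x => (cabs (f x) ^+ 2)%:E).
Proof. by move=> mf; apply/measurable_EFinP/measurable_funX/measurable_cabs. Qed.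

Lemma cmeasurable_comp d' (T' : measurableType d') (p : T' -> T) f :
  measurable_fun setT p -> cmeasurable f -> cmeasurable (fun x => f (p x)).
Proof.
by move=> mp [fr fi]; split; [exact: (measurableT_comp fr mp)|exact: (measurableT_comp fi mp)].
Qed.

End complex_measurability.

Section complex_integral.
Context d (T : measurableType d) (R : realType).
Variable mu : {measure set T -> \bar R}.
Implicit Types (f g : T -> R[i]) (h : T -> R).

Definition cintegrable f :=
  mu.-integrable setT (fun x => (complex.Re (f x))%:E) /\
  mu.-integrable setT (fun x => (complex.Im (f x))%:E).

(** The square of [L2norm], free of fractional powers; Tonelli, Bessel and Cauchy-Schwarz are
    applied in this form. *)
Definition sqnorm f : \bar R := (\int[mu]_x (cabs (f x) ^+ 2)%:E)%E.

Lemma cintegrable_le f h : cmeasurable f ->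
  mu.-integrable setT (EFin \o h) -> (forall x, cabs (f x) <= h x) -> cintegrable f.
Proof.
move=> [fr fi] ih fh; split; apply: le_integrable ih => //.
- exact/measurable_EFinP.
- move=> x _ /=; rewrite lee_fin (le_trans (ler_normRe_cabs _)) //.
  by rewrite (le_trans (fh x)) // ler_norm.
- exact/measurable_EFinP.
- move=> x _ /=; rewrite lee_fin (le_trans (ler_normIm_cabs _)) //.
  by rewrite (le_trans (fh x)) // ler_norm.
Qed.

Lemma cintegrableD f g :
  cintegrable f -> cintegrable g -> cintegrable (fun x => f x + g x).
Proof.
move=> [fr fi] [gr gi]; split.
  apply: eq_integrable (integrableD measurableT fr gr) => // x _ /=.
  by case: (f x); case: (g x).
apply: eq_integrable (integrableD measurableT fi gi) => // x _ /=.
by case: (f x); case: (g x).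
Qed.

Lemma cintegralD f g : cintegrable f -> cintegrable g ->
  cintegral mu (fun x => f x + g x) = cintegral mu f + cintegral mu g.
Proof.
move=> [fr fi] [gr gi]; rewrite /cintegral.
apply/eqP; rewrite eq_complex /= -!RintegralD //.
by apply/andP; split; apply/eqP/eq_Rintegral => x _; case: (f x); case: (g x).
Qed.

Lemma cintegrableZ (c : R[i]) f : cintegrable f -> cintegrable (fun x => c * f x).
Proof.
move=> [fr fi]; case: c => a b; split.
  apply: eq_integrable (integrableB measurableT (integrableZl measurableT a fr)
    (integrableZl measurableT b fi)) => // x _ /=.
  by case: (f x) => ? ?; rewrite /= EFinB !EFinM.
apply: eq_integrable (integrableD measurableT (integrableZl measurableT a fi)
    (integrableZl measurableT b fr)) => // x _ /=.
by case: (f x) => ? ?; rewrite /= EFinD !EFinM.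
Qed.

Lemma cintegralZ (c : R[i]) f : cintegrable f ->
  cintegral mu (fun x => c * f x) = c * cintegral mu f.
Proof.
move=> [fr fi]; case: c => a b; rewrite /cintegral.
have ZI (k : R) u : mu.-integrable setT (fun x => (u x)%:E) ->
    mu.-integrable setT (EFin \o (fun x => k * u x)).
  by move=> iu; apply: eq_integrable (integrableZl measurableT k iu).
apply/eqP; rewrite eq_complex /= -!RintegralZl // -RintegralB ?ZI // -RintegralD ?ZI //.
by apply/andP; split; apply/eqP/eq_Rintegral => x _; case: (f x).
Qed.

Lemma cintegral0 : cintegral mu (fun=> 0) = 0.
Proof. by rewrite /cintegral /Rintegral !integral0. Qed.

Lemma cintegrable0 : cintegrable (fun=> 0).
Proof. by split; exact: integrable0. Qed.

Lemma cintegrable_sum (I : Type) (s : seq I) (P : pred I) (F : I -> T -> R[i]) :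
  (forall i, cintegrable (F i)) -> cintegrable (fun x => \sum_(i <- s | P i) F i x).
Proof.
move=> iF; elim: s => [|i s ih].
  by under eq_fun do rewrite big_nil; exact: cintegrable0.
under eq_fun do rewrite big_cons.
by case: (P i) => //; exact: cintegrableD.
Qed.

Lemma cintegral_sum (I : Type) (s : seq I) (P : pred I) (F : I -> T -> R[i]) :
  (forall i, cintegrable (F i)) ->
  cintegral mu (fun x => \sum_(i <- s | P i) F i x) =
  \sum_(i <- s | P i) cintegral mu (F i).
Proof.
move=> iF; elim: s => [|i s ih].
  by under eq_fun do rewrite big_nil; rewrite big_nil cintegral0.
under eq_fun do rewrite big_cons.
rewrite big_cons -ih; case: (P i) => //.
by rewrite cintegralD //; exact: cintegrable_sum.
Qed.

Lemma cintegralJ f : cintegrable f ->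
  cintegral mu (fun x => conjc (f x)) = conjc (cintegral mu f).
Proof.
move=> [fr fi]; rewrite /cintegral /=.
apply/eqP; rewrite eq_complex /=; apply/andP; split; apply/eqP.
  by apply: eq_Rintegral => x _; case: (f x).
rewrite -mulN1r -RintegralZl //; apply: eq_Rintegral => x _.
by rewrite mulN1r; case: (f x).
Qed.

Lemma ae_eq_cintegral f g : cmeasurable f -> cmeasurable g ->
  f = g %[ae mu] -> cintegral mu f = cintegral mu g.
Proof.
move=> [fr fi] [gr gi] fg; rewrite /cintegral /Rintegral.
congr (Complex (fine _) (fine _)); apply: ae_eq_integral => //;
  do ?exact/measurable_EFinP; by apply: filterS fg => x /= + _ => ->.
Qed.

Lemma sqnorm_ge0 f : (0 <= sqnorm f)%E.
Proof. by apply: integral_ge0 => x _; rewrite lee_fin sqr_ge0. Qed.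

Lemma poweR_L2norm f : (L2norm mu f `^ 2 = sqnorm f)%E.
Proof.
rewrite /L2norm poweR_Lnorm ?pnatr_eq0 //; apply: eq_integral => x _ /=.
by rewrite ger0_norm ?cabs_ge0 // powR_mulrn // cabs_ge0.
Qed.

Lemma L2normE f : (L2norm mu f = sqnorm f `^ 2^-1)%E.
Proof. by rewrite -poweR_L2norm -poweRrM divff ?pnatr_eq0 // poweRe1 // Lnorm_ge0. Qed.

Lemma square_integrableP f :
  square_integrable mu f <-> cmeasurable f /\ (sqnorm f < +oo)%E.
Proof.
split=> -[mf fy]; split=> //.
  by rewrite -poweR_L2norm; exact: poweR_lty.
by rewrite L2normE; exact: poweR_lty.
Qed.

Lemma ae_le_sqnorm (B : R) f g : cmeasurable f -> cmeasurable g ->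
  (\forall x \ae mu, cabs (g x) <= B * cabs (f x)) ->
  (sqnorm g <= (B ^+ 2)%:E * sqnorm f)%E.
Proof.
move=> mf mg gf; rewrite /sqnorm -ge0_integralZl//; last 3 first.
- exact: measurable_cabs2.
- by move=> x _; rewrite lee_fin sqr_ge0.
- by rewrite lee_fin sqr_ge0.
apply: ae_ge0_le_integral => //.
- by move=> x _; rewrite lee_fin sqr_ge0.
- exact: measurable_cabs2.
- by move=> x _; rewrite mule_ge0 // lee_fin sqr_ge0.
- by apply: measurable_funeM; exact: measurable_cabs2.
apply: filterS gf => x gf _; rewrite -EFinM lee_fin -exprMn.
by rewrite lerXn2r ?nnegrE ?cabs_ge0 // (le_trans (cabs_ge0 (g x))).
Qed.

Lemma ae_le_L2norm (B : R) f g : 0 <= B -> cmeasurable f -> cmeasurable g ->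
  (\forall x \ae mu, cabs (g x) <= B * cabs (f x)) ->
  (L2norm mu g <= B%:E * L2norm mu f)%E.
Proof.
move=> B0 mf mg gf; rewrite !L2normE.
have -> : (B%:E = (B ^+ 2)%:E `^ 2^-1)%E.
  by rewrite poweR_EFin powR12_sqrt ?sqr_ge0 // sqrtr_sqr ger0_norm.
rewrite -poweRM ?sqnorm_ge0 ?lee_fin ?sqr_ge0 //.
apply: gt0_ler_poweR; rewrite ?in_itv /= ?leey ?andbT //.
- exact: sqnorm_ge0.
- by rewrite mule_ge0 ?sqnorm_ge0 // lee_fin sqr_ge0.
- exact: ae_le_sqnorm.
Qed.

Lemma ae_eq_sqnorm f g : cmeasurable f -> cmeasurable g ->
  f = g %[ae mu] -> sqnorm f = sqnorm g.
Proof.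
move=> mf mg fg; apply: ae_eq_integral => //; do ?exact: measurable_cabs2.
by apply: filterS fg => x /= + _ => ->.
Qed.

Lemma ae_le_square_integrable (B : R) f g : square_integrable mu f -> cmeasurable g ->
  (\forall x \ae mu, cabs (g x) <= B * cabs (f x)) -> square_integrable mu g.
Proof.
move=> /square_integrableP[mf fy] mg gf; apply/square_integrableP; split=> //.
apply: le_lt_trans (ae_le_sqnorm mf mg gf) _.
by rewrite lte_mul_pinfty // ?lee_fin ?sqr_ge0.
Qed.

Lemma square_integrableJ f :
  square_integrable mu f -> square_integrable mu (fun x => conjc (f x)).
Proof.
move=> sf; apply: (@ae_le_square_integrable 1 f) => //.
  by case: sf => mf _; exact: cmeasurableJ.
by apply: aeW => x; rewrite cabsJ mul1r.
Qed.

(** The crude bound [s * t <= s ^+ 2 + t ^+ 2] on the moduli supplies an integrable majorant. *)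
Lemma cintegrableM f g : square_integrable mu f -> square_integrable mu g ->
  cintegrable (fun x => f x * g x).
Proof.
move=> /square_integrableP[mf fy] /square_integrableP[mg gy].
have isq u : cmeasurable u -> (sqnorm u < +oo)%E ->
    mu.-integrable setT (fun x => (cabs (u x) ^+ 2)%:E).
  move=> mu_ uy; apply/integrableP; split; first exact: measurable_cabs2.
  by under eq_integral do rewrite gee0_abs ?lee_fin ?sqr_ge0 //.
apply: (@cintegrable_le _ (fun x => cabs (f x) ^+ 2 + cabs (g x) ^+ 2)).
- exact: cmeasurableM.
- exact: eq_integrable (integrableD measurableT (isq _ mf fy) (isq _ mg gy)).
- move=> x; rewrite cabsM; have := cabs_ge0 (f x); have := cabs_ge0 (g x).
  by move: (cabs _) (cabs _) => s t s0 t0; nra.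
Qed.

End complex_integral.

Section L2_inner.
Context d (T : measurableType d) (R : realType).
Variable mu : {measure set T -> \bar R}.
Implicit Types (f g : T -> R[i]) (u v w : L2 mu).
Local Open Scope quotient_scope.

Lemma L2_square_integrable u : square_integrable mu u.
Proof. exact/asboolP/(L2fun_valP (repr u)). Qed.

Lemma L2_cmeasurable u : cmeasurable u.
Proof. by case: (L2_square_integrable u). Qed.

Lemma L2_pi_ae (f : L2fun mu) : L2_fun (\pi_(L2 mu) f) = val f %[ae mu].
Proof.
have : \pi_(L2 mu) (repr (\pi_(L2 mu) f)) == \pi_(L2 mu) f by rewrite reprK.
by rewrite eqmodE => /asboolP.
Qed.

Lemma L2_ae_eq u v : L2_fun u = L2_fun v %[ae mu] -> u = v.
Proof.
move=> uv; rewrite -(reprK u) -(reprK v); apply/eqP; rewrite eqmodE.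
exact/asboolP.
Qed.

(** Operations on classes go through representatives chosen by [repr], so pointwise rules hold only
    outside a null set. *)
Lemma L2D_ae u v : \forall x \ae mu, L2_fun (u + v) x = u x + v x.
Proof.
by apply: filterS (L2_pi_ae (repr u + repr v)) => x /(_ I) ->; rewrite raddfD.
Qed.

Lemma L2Z_ae (c : R[i]) u : \forall x \ae mu, L2_fun (c *: u) x = c * u x.
Proof.
by apply: filterS (L2_pi_ae (c *: repr u)) => x /(_ I) ->; rewrite linearZ.
Qed.

Lemma L2_lin_ae (c : R[i]) u v :
  \forall x \ae mu, L2_fun (c *: u + v) x = c * u x + v x.
Proof. by move: (L2D_ae (c *: u) v) (L2Z_ae c u); apply: filterS2 => x -> ->. Qed.

Lemma L2_0_ae : \forall x \ae mu, L2_fun (0 : L2 mu) x = 0.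
Proof. by have := L2Z_ae 0 0; apply: filterS => x; rewrite scale0r mul0r. Qed.

Lemma toL2_ae f : square_integrable mu f -> \forall x \ae mu, toL2 mu f x = f x.
Proof. by move=> /toL2K; apply: filterS => x; apply. Qed.

Lemma eq_toL2 f g : square_integrable mu f -> square_integrable mu g ->
  (\forall x \ae mu, f x = g x) -> toL2 mu f = toL2 mu g.
Proof.
move=> sf sg fg; apply: L2_ae_eq; move: (toL2_ae sf) (toL2_ae sg) fg.
by apply: filterS3 => x -> -> ->.
Qed.

Lemma toL2_eq f u : square_integrable mu f ->
  (\forall x \ae mu, f x = u x) -> toL2 mu f = u.
Proof.
move=> sf fu; apply: L2_ae_eq; move: (toL2_ae sf) fu.
by apply: filterS2 => x -> ->.
Qed.

Lemma square_integrable_lin (c : R[i]) f g :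
  square_integrable mu f -> square_integrable mu g ->
  square_integrable mu (fun x => c * f x + g x).
Proof. exact: square_integrable_submod. Qed.

Lemma toL2_lin (c : R[i]) f g : square_integrable mu f -> square_integrable mu g ->
  toL2 mu (fun x => c * f x + g x) = c *: toL2 mu f + toL2 mu g.
Proof.
move=> sf sg; apply: toL2_eq; first exact: square_integrable_lin.
move: (L2_lin_ae c (toL2 mu f) (toL2 mu g)) (toL2_ae sf) (toL2_ae sg).
by apply: filterS3 => x -> -> ->.
Qed.

Lemma square_integrable_sum (I : Type) (s : seq I) (P : pred I) (c : I -> R[i])
    (F : I -> T -> R[i]) : (forall i, P i -> square_integrable mu (F i)) ->
  square_integrable mu (fun x => \sum_(i <- s | P i) c i * F i x).
Proof.
move=> sF; elim: s => [|i s ih].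
  rewrite (_ : (fun _ => _) = fun=> 0); first exact: (square_integrable0 mu).
  by apply/funext => x; rewrite big_nil.
rewrite (_ : (fun x : T => \sum_(j <- i :: s | P j) _) = fun x => if P i then
    c i * F i x + \sum_(j <- s | P j) c j * F j x else \sum_(j <- s | P j) c j * F j x).
  by case Pi: (P i) => //; apply: square_integrable_lin => //; exact: sF.
by apply/funext => x; rewrite big_cons.
Qed.

Lemma toL2_sum (I : Type) (s : seq I) (P : pred I) (c : I -> R[i])
    (F : I -> T -> R[i]) : (forall i, P i -> square_integrable mu (F i)) ->
  toL2 mu (fun x => \sum_(i <- s | P i) c i * F i x) =
  \sum_(i <- s | P i) c i *: toL2 mu (F i).
Proof.
move=> sF; elim: s => [|i s ih].
  rewrite big_nil (_ : (fun _ => _) = fun=> 0).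
    by apply: toL2_eq; [exact: (square_integrable0 mu)|apply: filterS L2_0_ae => x ->].
  by apply/funext => x; rewrite big_nil.
rewrite (_ : (fun x : T => \sum_(j <- i :: s | P j) _) = fun x => if P i then
    c i * F i x + \sum_(j <- s | P j) c j * F j x else \sum_(j <- s | P j) c j * F j x).
  rewrite big_cons -ih; case Pi: (P i) => //.
  by rewrite toL2_lin //; [exact: sF|exact: square_integrable_sum].
by apply/funext => x; rewrite big_cons.
Qed.

Definition sqn u : R := fine (sqnorm mu u).

Lemma sqnE u : sqnorm mu u = (sqn u)%:E.
Proof.
have /square_integrableP[_ uy] := L2_square_integrable u.
by rewrite /sqn fineK // ge0_fin_numE // sqnorm_ge0.
Qed.

Lemma sqn_ge0 u : 0 <= sqn u.
Proof. by rewrite fine_ge0 // sqnorm_ge0. Qed.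

Lemma L2norm_sqn u : L2norm mu u = (Num.sqrt (sqn u))%:E.
Proof. by rewrite L2normE sqnE poweR_EFin -powR12_sqrt // sqn_ge0. Qed.

Lemma sqnorm_toL2 f : square_integrable mu f -> (sqn (toL2 mu f))%:E = sqnorm mu f.
Proof.
move=> sf; rewrite -sqnE; apply: ae_eq_sqnorm; last exact: toL2K.
  exact: L2_cmeasurable.
exact: (proj1 sf).
Qed.

Lemma inner_cintegrable u v : cintegrable mu (fun x => u x * conjc (v x)).
Proof.
by apply: cintegrableM; [|apply: square_integrableJ]; exact: L2_square_integrable.
Qed.

Lemma inner_cmeasurable u v : cmeasurable (fun x => u x * conjc (v x)).
Proof.
by apply: cmeasurableM; [|apply: cmeasurableJ]; exact: L2_cmeasurable.
Qed.

Lemma innerDl u v w : inner (u + v) w = inner u w + inner v w.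
Proof.
rewrite /inner -cintegralD; do ?exact: inner_cintegrable.
apply: ae_eq_cintegral; [|apply: cmeasurableD|]; do ?exact: inner_cmeasurable.
by apply: filterS (L2D_ae u v) => x -> _; rewrite mulrDl.
Qed.

Lemma innerZl (c : R[i]) u v : inner (c *: u) v = c * inner u v.
Proof.
rewrite /inner -cintegralZ; do ?exact: inner_cintegrable.
apply: ae_eq_cintegral.
- exact: inner_cmeasurable.
- by apply: cmeasurableM; [exact: cmeasurable_cst|exact: inner_cmeasurable].
- by apply: filterS (L2Z_ae c u) => x -> _; rewrite mulrA.
Qed.

Lemma innerC u v : inner v u = conjc (inner u v).
Proof.
rewrite /inner -cintegralJ; last exact: inner_cintegrable.
by congr cintegral; apply/funext => x; rewrite rmorphM /= conjcK mulrC.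
Qed.

Lemma innerDr u v w : inner w (u + v) = inner w u + inner w v.
Proof. by rewrite (innerC _ w) innerDl rmorphD /= (innerC u w) (innerC v w). Qed.

Lemma innerZr (c : R[i]) u v : inner v (c *: u) = conjc c * inner v u.
Proof. by rewrite (innerC _ v) innerZl rmorphM /= (innerC u v). Qed.

Lemma inner0l u : inner 0 u = 0.
Proof. by rewrite -(scale0r 0) innerZl mul0r. Qed.

Lemma inner0r u : inner u 0 = 0.
Proof. by rewrite innerC inner0l conjc0. Qed.

Lemma innerNl u v : inner (- u) v = - inner u v.
Proof. by rewrite -scaleN1r innerZl mulN1r. Qed.

Lemma innerNr u v : inner v (- u) = - inner v u.
Proof. by rewrite (innerC _ v) innerNl rmorphN /= (innerC u v). Qed.

Lemma inner_suml (I : Type) (s : seq I) (P : pred I) (F : I -> L2 mu) u :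
  inner (\sum_(i <- s | P i) F i) u = \sum_(i <- s | P i) inner (F i) u.
Proof. by elim/big_rec2: _ => [|i y x _ <-]; rewrite ?inner0l // innerDl. Qed.

Lemma inner_sumr (I : Type) (s : seq I) (P : pred I) (F : I -> L2 mu) u :
  inner u (\sum_(i <- s | P i) F i) = \sum_(i <- s | P i) inner u (F i).
Proof. by elim/big_rec2: _ => [|i y x _ <-]; rewrite ?inner0r // innerDr. Qed.

Lemma inner_self u : inner u u = (sqn u)%:C%C.
Proof.
rewrite /inner (_ : (fun _ => _) = fun x => (cabs (u x) ^+ 2)%:C%C).
  by rewrite /cintegral /=; congr Complex; rewrite /Rintegral integral0.
by apply/funext => x; rewrite mulcJ.
Qed.

Lemma sqn_eq0 u : sqn u = 0 -> u = 0.
Proof.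
move=> u0; apply: L2_ae_eq.
have mu2 := measurable_cabs2 (L2_cmeasurable u).
have := (ae_eq_integral_abs mu measurableT mu2).1.
under eq_integral do rewrite gee0_abs ?lee_fin ?sqr_ge0 //.
rewrite -/(sqnorm mu u) sqnE u0 => /(_ erefl) ae0.
move: ae0 L2_0_ae; apply: filterS2 => x + -> _ => /(_ I) /= [] /eqP.
by rewrite sqrf_eq0 => /eqP /cabs_eq0.
Qed.

Lemma sqnZ (c : R[i]) u : sqn (c *: u) = cabs c ^+ 2 * sqn u.
Proof.
apply: complexRI; rewrite -inner_self innerZl innerZr inner_self mulrA mulcJ.
by rewrite -rmorphM.
Qed.

Lemma sqn0 : sqn 0 = 0.
Proof. by apply: complexRI; rewrite -inner_self inner0l. Qed.

(* Read off from 0 <= |v - \sum_i <v, e_i> e_i|^2. *)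
Lemma bessel (I : finType) (e : I -> L2 mu) v :
  (forall i j, inner (e i) (e j) = (i == j)%:R) ->
  \sum_i cabs (inner v (e i)) ^+ 2 <= sqn v.
Proof.
move=> oe; pose s := \sum_i inner v (e i) *: e i.
pose S : R := \sum_i cabs (inner v (e i)) ^+ 2.
have vs : inner v s = S%:C%C.
  rewrite inner_sumr rmorph_sum; apply: eq_bigr => i _ /=.
  by rewrite innerZr mulrC mulcJ.
have ss : inner s s = S%:C%C.
  rewrite {1}/s inner_suml rmorph_sum; apply: eq_bigr => i _ /=.
  rewrite innerZl /s inner_sumr (bigD1 i) //= innerZr oe eqxx mulr1.
  rewrite big1 ?addr0 ?mulcJ // => j ji.
  by rewrite innerZr oe eq_sym (negbTE ji) mulr0.
have : inner (v - s) (v - s) = (sqn v - S)%:C%C.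
  rewrite innerDl !innerDr !innerNl !innerNr vs ss (innerC v s) vs inner_self.
  by rewrite conjc_real opprK addNr addr0 rmorphB.
by rewrite inner_self => /complexRI vsE; rewrite -subr_ge0 -vsE sqn_ge0.
Qed.

(** Bessel's inequality for the family whose only term is [v] normalized; [v = 0] is set apart. *)
Lemma cauchy_schwarz u v : cabs (inner u v) ^+ 2 <= sqn u * sqn v.
Proof.
have [v0|v0] := eqVneq (sqn v) 0.
  by rewrite (sqn_eq0 v0) inner0r cabs0 sqn0 expr0n mulr0.
have vgt0 : 0 < sqn v by rewrite lt_def v0 sqn_ge0.
pose e := ((Num.sqrt (sqn v))^-1)%:C%C *: v.
have re : ((Num.sqrt (sqn v))^-1) ^+ 2 = (sqn v)^-1.
  by rewrite exprVn sqr_sqrtr // sqn_ge0.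
have ee : inner e e = 1.
  rewrite inner_self sqnZ cabs_real real_normK ?num_real // re mulVf //.
have : cabs (inner u e) ^+ 2 <= sqn u.
  have /(_ u) := @bessel 'I_1 (fun=> e); rewrite big_ord1; apply=> i j.
  by rewrite ee !ord1 eqxx.
rewrite innerZr cabsM cabsJ cabs_real exprMn real_normK ?num_real // re.
by rewrite ler_pdivrMl // mulrC.
Qed.

End L2_inner.

(** * Orthonormal bases and integral operators *)

(* The library's theory of sesquilinear forms also defines [orthonormal]. *)
Local Notation orthonormal := Defs.orthonormal.

Section orthonormal_bases.
Context d (T : measurableType d) (R : realType).
Variable mu : {measure set T -> \bar R}.
Implicit Types (u e : L2 mu) (B : set (L2 mu)).

Lemma normalizeL2 u : u != 0 ->
  let e := ((Num.sqrt (sqn u))^-1)%:C%C *: u in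
  inner e e = 1 /\ u = (Num.sqrt (sqn u))%:C%C *: e.
Proof.
move=> u0 e; have su : sqn u != 0 by apply: contra_neq u0 => /sqn_eq0.
have s0 : Num.sqrt (sqn u) != 0.
  by rewrite sqrtr_eq0 -ltNge lt_def su sqn_ge0.
split.
  rewrite inner_self sqnZ cabs_real real_normK ?num_real // exprVn.
  by rewrite sqr_sqrtr ?sqn_ge0 // mulVf.
by rewrite scalerA -rmorphM /= divff // scale1r.
Qed.

Lemma orthonormalU1 B e : orthonormal B -> inner e e = 1 ->
  (forall f, B f -> inner e f = 0) -> orthonormal (B `|` [set e]).
Proof.
move=> oB ee Be f g [Bf|->] [Bg|->].
- exact: oB.
- rewrite innerC Be // conjc0; case: eqP => // fe.
  by move: (Be f Bf); rewrite fe ee => /eqP; rewrite oner_eq0.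
- rewrite Be //; case: eqP => // eg.
  by move: (Be g Bg); rewrite -eg ee => /eqP; rewrite oner_eq0.
- by rewrite ee eqxx.
Qed.

(* Zorn's lemma applied to the sets that stay orthonormal after adding [B0]. *)
Lemma orthonormal_basis_extend B0 : orthonormal B0 ->
  exists2 B, orthonormal_basis B & B0 `<=` B.
Proof.
move=> oB0; pose P := [set B | orthonormal (B `|` B0)].
have [F FP totF|A [oA maxA]] := @Zorn_bigcup _ P.
  move=> f g [[A FA Af]|Bf] [[A' FA' Ag]|Bg].
  - have [AA'|A'A] := totF _ _ FA FA'.
      by apply: (FP _ FA'); left => //; exact: AA'.
    by apply: (FP _ FA); left => //; exact: A'A.
  - by apply: (FP _ FA); [left|right].
  - by apply: (FP _ FA'); [right|left].
  - exact: oB0.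
exists (A `|` B0); last by move=> f; right.
(* A nonzero [u] orthogonal to the whole set would, once normalized, enlarge [A] against its
   maximality. *)
split=> // u uB; have [//|u0] := eqVneq u 0; exfalso.
have [ee uE] := normalizeL2 u0; set e := (_ *: u) in ee uE.
have eB f : (A `|` B0) f -> inner e f = 0 by move=> /uB uf; rewrite innerZl uf mulr0.
have oAe := orthonormalU1 oA ee eB.
apply: (maxA (A `|` [set e])).
  rewrite properEneq; split; last by move=> f; left.
  apply/eqP => AE; have Ae : A e by rewrite AE; right.
  by have := eB e (or_introl Ae); rewrite ee => /eqP; rewrite oner_eq0.
by rewrite /P /= setUAC.
Qed.

Lemma orthonormal_basis_exists : exists B, @orthonormal_basis _ _ _ mu B.
Proof.
have [//|B oB _] := @orthonormal_basis_extend set0.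
by exists B.
Qed.

End orthonormal_bases.

Section operator_norms.
Context d1 d2 (X : measurableType d1) (Y : measurableType d2) (R : realType).
Variables (mu : {measure set X -> \bar R}) (nu : {measure set Y -> \bar R}).

(* A unit vector extends to an orthonormal basis, one of whose terms already
   accounts for |F e|^2. *)
Lemma opnorm_le_HSnorm (F : L2 mu -> L2 nu) : scalable F -> (opnorm F <= HSnorm F)%E.
Proof.
move=> FZ; apply: ge_ereal_sup => _ [u u1 <-].
have [->|u0] := eqVneq u 0.
  by rewrite -(scale0r 0) FZ scale0r L2norm_sqn sqn0 sqrtr0; exact: poweR_ge0.
have [ee uE] := normalizeL2 u0; set e := (_ *: u) in ee uE.
have -> : L2norm nu (F u) = ((Num.sqrt (sqn u))%:E * L2norm nu (F e))%E.
  rewrite [in LHS]uE FZ !L2norm_sqn sqnZ cabs_real -EFinM.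
  rewrite ger0_norm ?sqrtr_ge0 // sqrtrM ?sqr_ge0 //.
  by rewrite sqrtr_sqr ger0_norm ?sqrtr_ge0.
apply: (@le_trans _ _ (L2norm nu (F e))).
  rewrite L2norm_sqn -EFinM lee_fin ler_piMl ?sqrtr_ge0 //.
  by move: u1; rewrite /= L2norm_sqn lee_fin.
have oe : orthonormal [set e] by move=> f g -> ->; rewrite ee eqxx.
have [B oB eB] := orthonormal_basis_extend oe.
pose SF := (\esum_(f in B) (L2norm nu (F f) `^ 2)%E)%R.
have SFsup : [set (\esum_(e in B) (L2norm nu (F e) `^ 2)%E)%R |
    B in orthonormal_basis (mu := mu)] SF by exists B.
rewrite L2normE /HSnorm.
apply: gt0_ler_poweR => //; rewrite ?in_itv /= ?leey ?andbT ?sqnorm_ge0 //.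
  apply: le_trans (ereal_sup_ubound SFsup).
  by apply: esum_ge0 => f _; exact: poweR_ge0.
apply: le_trans (ereal_sup_ubound SFsup).
apply: esum_ge; exists [set e]; first by split.
by rewrite fsbig_set1 poweR_L2norm.
Qed.

End operator_norms.

(** * Integral operators with square-integrable kernels *)

Section kernel_operators.
Context d1 d2 (X : measurableType d1) (Y : measurableType d2) (R : realType).
Variables (mu : {sigma_finite_measure set X -> \bar R}).
Variables (nu : {sigma_finite_measure set Y -> \bar R}).
Implicit Types (k : X * Y -> R[i]) (f : X -> R[i]) (u : L2 mu).

(** Tonelli gives measurable partial integrals for nonnegative functions; the positive and negative
    parts are treated separately and subtracted in the extended reals, before [fine]. *)
Lemma measurable_Rintegral_section (h : X * Y -> R) : measurable_fun setT h ->
  measurable_fun setT (fun y => \int[mu]_x h (x, y)).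
Proof.
move=> mh; have mhE : measurable_fun setT (EFin \o h) by exact/measurable_EFinP.
apply: (measurableT_comp (f := @fine R)) => //.
under eq_fun do rewrite integralE.
have mp : measurable_fun setT (EFin \o h)^\+%E by exact: measurable_funepos.
have mn : measurable_fun setT (EFin \o h)^\-%E by exact: measurable_funeneg.
apply: emeasurable_funB.
  have := measurable_fun_fubini_tonelli_G (m1 := mu) _ mp (funepos_ge0 _).
  by rewrite /fubini_G unlock.
have := measurable_fun_fubini_tonelli_G (m1 := mu) _ mn (funeneg_ge0 _).
by rewrite /fubini_G unlock.
Qed.

(** Where the slice is not integrable against [f], the value is whatever [cintegral] returns; for
    square-integrable [k] and [f] such [y] form a null set. *)
Definition kernel_fun k f (y : Y) : R[i] := cintegral mu (fun x => k (x, y) * f x).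

Lemma cmeasurable_kernel_fun k f :
  cmeasurable k -> cmeasurable f -> cmeasurable (kernel_fun k f).
Proof.
move=> mk mf.
have [mr mi] : cmeasurable (fun xy : X * Y => k xy * f xy.1).
  by apply: cmeasurableM => //; exact: cmeasurable_comp measurable_fst mf.
by split; [exact: measurable_Rintegral_section mr|exact: measurable_Rintegral_section mi].
Qed.

Lemma cmeasurable_slice k y : cmeasurable k -> cmeasurable (fun x => k (x, y)).
Proof. by apply: cmeasurable_comp; exact: pair2_measurable. Qed.

Lemma sqnorm_slices k : cmeasurable k ->
  sqnorm (mu \x nu)%E k = (\int[nu]_y sqnorm mu (fun x => k (x, y)))%E.
Proof.
move=> mk; rewrite {1}/sqnorm fubini_tonelli2 //; first exact: measurable_cabs2.
by move=> xy; rewrite lee_fin sqr_ge0.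
Qed.

Lemma measurable_sqnorm_slice k : cmeasurable k ->
  measurable_fun setT (fun y => sqnorm mu (fun x => k (x, y))).
Proof.
move=> mk.
apply: (measurable_fun_fubini_tonelli_G (fun xy => (cabs (k xy) ^+ 2)%:E)).
  exact: measurable_cabs2.
by move=> xy; rewrite lee_fin sqr_ge0.
Qed.

(** By Tonelli the squared norms of the slices have a finite integral over [y], so almost all of
    them are finite. *)
Lemma slice_square_integrable k : square_integrable (mu \x nu)%E k ->
  \forall y \ae nu, square_integrable mu (fun x => k (x, y)).
Proof.
move=> /square_integrableP[mk ky].
have : nu.-integrable setT (fun y => sqnorm mu (fun x => k (x, y))).
  apply/integrableP; split; first exact: measurable_sqnorm_slice.
  under eq_integral do rewrite gee0_abs ?sqnorm_ge0 //.
  by rewrite -sqnorm_slices.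
move=> /(integrable_ae measurableT); apply: filterS => y /(_ I) fy.
apply/square_integrableP; split; first exact: cmeasurable_slice.
by rewrite ltey_eq fy.
Qed.

(** The vector is the conjugated slice. Turning the value at [y] into an inner product lets Hilbert
    space inequalities act pointwise in [y]; only moduli are compared, so the order of the arguments
    can be the one used in [bessel]. *)
Lemma kernel_fun_inner k y : square_integrable mu (fun x => k (x, y)) ->
  exists2 v : L2 mu, sqnorm mu (fun x => k (x, y)) = (sqn v)%:E &
    forall u : L2 mu, cabs (kernel_fun k u y) = cabs (inner v u).
Proof.
move=> sk; exists (toL2 mu (fun x => conjc (k (x, y)))).
  rewrite -sqnE; have sJ := square_integrableJ sk.
  rewrite (ae_eq_sqnorm (L2_cmeasurable _) (proj1 sJ) (toL2K sJ)).
  by apply: eq_integral => x _; rewrite cabsJ.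
move=> u; rewrite /inner -(cabsJ (kernel_fun _ _ _)) /kernel_fun.
rewrite -cintegralJ; last exact: cintegrableM sk (L2_square_integrable u).
have sJ := square_integrableJ sk; congr cabs; apply: ae_eq_cintegral.
- apply/cmeasurableJ/cmeasurableM; last exact: L2_cmeasurable.
  exact: (proj1 sk).
- exact: inner_cmeasurable.
- by apply: filterS (toL2K sJ) => x /= -> // _; rewrite rmorphM.
Qed.

Lemma kernel_bessel (I : finType) (e : I -> L2 mu) k :
  square_integrable (mu \x nu)%E k ->
  (forall i j, inner (e i) (e j) = (i == j)%:R) ->
  (\sum_i sqnorm nu (kernel_fun k (e i)) <= sqnorm (mu \x nu)%E k)%E.
Proof.
move=> sk oe; have [mk _] := sk.
have mT i : measurable_fun setT (fun y => (cabs (kernel_fun k (e i) y) ^+ 2)%:E).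
  by apply/measurable_cabs2/cmeasurable_kernel_fun => //; exact: L2_cmeasurable.
rewrite /sqnorm -ge0_integral_sum //; last first.
  by move=> i y _; rewrite lee_fin sqr_ge0.
rewrite -/(sqnorm (mu \x nu)%E k) sqnorm_slices //.
apply: ae_ge0_le_integral => //.
- by move=> y _; apply: sume_ge0 => i _; rewrite lee_fin sqr_ge0.
- exact: emeasurable_sum.
- by move=> y _; exact: sqnorm_ge0.
- exact: measurable_sqnorm_slice.
apply: filterS (slice_square_integrable sk) => y sy _.
have [v -> vE] := kernel_fun_inner sy.
under eq_bigr do rewrite vE; rewrite sumEFin lee_fin; exact: bessel.
Qed.

(** Cauchy-Schwarz in almost every slice, integrated over [y]. This makes the operator land in L^2
    and bounds its norm by that of the kernel. *)
Lemma sqnorm_kernel_fun k u : square_integrable (mu \x nu)%E k ->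
  (sqnorm nu (kernel_fun k u) <= sqnorm (mu \x nu)%E k * (sqn u)%:E)%E.
Proof.
move=> sk; have [mk _] := sk.
rewrite sqnorm_slices // -ge0_integralZr //; last 3 first.
- exact: measurable_sqnorm_slice.
- by move=> y _; exact: sqnorm_ge0.
- by rewrite lee_fin sqn_ge0.
apply: ae_ge0_le_integral => //.
- by move=> y _; rewrite lee_fin sqr_ge0.
- by apply/measurable_cabs2/cmeasurable_kernel_fun => //; exact: L2_cmeasurable.
- by move=> y _; rewrite mule_ge0 ?sqnorm_ge0 // lee_fin sqn_ge0.
- by apply: emeasurable_funM => //; exact: measurable_sqnorm_slice.
apply: filterS (slice_square_integrable sk) => y sy _.
have [v -> vE] := kernel_fun_inner sy.
by rewrite vE -EFinM lee_fin; exact: cauchy_schwarz.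
Qed.

Lemma kernel_fun_square_integrable k u : square_integrable (mu \x nu)%E k ->
  square_integrable nu (kernel_fun k u).
Proof.
move=> sk; have /square_integrableP[mk ky] := sk.
apply/square_integrableP; split.
  by apply: cmeasurable_kernel_fun => //; exact: L2_cmeasurable.
apply: le_lt_trans (sqnorm_kernel_fun u sk) _.
by rewrite muleC lte_mul_pinfty // lee_fin sqn_ge0.
Qed.

Definition kernel_op k u : L2 nu := toL2 nu (kernel_fun k u).

Lemma kernel_op_linear k : square_integrable (mu \x nu)%E k -> linear (kernel_op k).
Proof.
move=> sk c u v; rewrite /kernel_op -toL2_lin; do ?exact: kernel_fun_square_integrable.
apply: eq_toL2; first exact: kernel_fun_square_integrable.
  by apply: square_integrable_lin; exact: kernel_fun_square_integrable.
(* At such a [y] all the integrals converge, so integration is linear. *)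
apply: filterS (slice_square_integrable sk) => y sy.
have iM w : cintegrable mu (fun x => k (x, y) * L2_fun (w : L2 mu) x).
  exact: cintegrableM sy (L2_square_integrable w).
have mk : cmeasurable (fun x => k (x, y)) by exact: (proj1 sy).
rewrite /kernel_fun -cintegralZ // -cintegralD //; last exact: cintegrableZ.
apply: ae_eq_cintegral.
- by apply: cmeasurableM => //; exact: L2_cmeasurable.
- apply: cmeasurableD; first apply: cmeasurableM; first exact: cmeasurable_cst.
  + by apply: cmeasurableM => //; exact: L2_cmeasurable.
  + by apply: cmeasurableM => //; exact: L2_cmeasurable.
- apply: filterS (L2_lin_ae c u v) => x -> _.
  by rewrite mulrDr mulrCA.
Qed.

Lemma kernel_opB k k' u :
  square_integrable (mu \x nu)%E k -> square_integrable (mu \x nu)%E k' ->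
  kernel_op k u - kernel_op k' u = kernel_op (fun xy => k xy - k' xy) u.
Proof.
move=> sk sk'.
have skk : square_integrable (mu \x nu)%E (fun xy => k xy - k' xy).
  rewrite (_ : (fun _ => _) = fun xy => -1 * k' xy + k xy).
    exact: square_integrable_lin.
  by apply/funext => xy; rewrite mulN1r addrC.
rewrite addrC -scaleN1r /kernel_op -toL2_lin; do ?exact: kernel_fun_square_integrable.
apply: eq_toL2; last 2 first.
- exact: kernel_fun_square_integrable.
- move: (slice_square_integrable sk) (slice_square_integrable sk').
  apply: filterS2 => y sy sy'.
  have su := L2_square_integrable u.
  rewrite /kernel_fun -cintegralZ; last exact: cintegrableM.
  rewrite -cintegralD; [|apply: cintegrableZ|]; do ?exact: cintegrableM.
  by congr cintegral; apply/funext => x; rewrite mulrBl mulN1r addrC.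
- by apply: square_integrable_lin; exact: kernel_fun_square_integrable.
Qed.

Lemma sqn_kernel_op k u : square_integrable (mu \x nu)%E k ->
  ((sqn (kernel_op k u))%:E <= sqnorm (mu \x nu)%E k * (sqn u)%:E)%E.
Proof.
move=> sk; rewrite sqnorm_toL2; last exact: kernel_fun_square_integrable.
exact: sqnorm_kernel_fun.
Qed.

Lemma HSnorm_kernel_op k : square_integrable (mu \x nu)%E k ->
  (HSnorm (kernel_op k) <= L2norm (mu \x nu)%E k)%E.
Proof.
move=> sk; rewrite L2normE /HSnorm.
apply: gt0_ler_poweR => //; rewrite ?in_itv /= ?leey ?andbT ?sqnorm_ge0 //.
  (* Monotonicity of the power is used on nonnegative values; the existence of a basis keeps the
     supremum from being that of the empty set. *)
  apply: le_ereal_sup_tmp.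
  have [B oB] := @orthonormal_basis_exists _ _ _ mu.
  exists (\esum_(e in B) (L2norm nu (kernel_op k e) `^ 2)%E)%R; first by exists B.
  by apply: esum_ge0 => e _; exact: poweR_ge0.
(* [esum] is a supremum of finite partial sums, each running over a finite orthonormal family. *)
apply: ge_ereal_sup => _ [B [oB _] <-]; apply: ge_ereal_sup => _ [A [finA AB] <-].
rewrite fsbig_finite //= big_seq_fsetE /=.
pose e (i : fset_set A) : L2 mu := val i.
rewrite (eq_bigr (fun i => sqnorm nu (kernel_fun k (e i)))) => [|i _].
  apply: kernel_bessel => // i j; rewrite oB ?(inj_eq val_inj) //; apply: AB.
    by have := valP i; rewrite in_fset_set // => /set_mem.
  by have := valP j; rewrite in_fset_set // => /set_mem.
rewrite poweR_L2norm sqnE sqnorm_toL2 //; exact: kernel_fun_square_integrable.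
Qed.

End kernel_operators.

(** * Finite rank and spectral projections *)

Section finite_rank.
Context (R : realType).
Implicit Types (V W : lmodType R[i]).

(** If [n > D], the coefficient matrix has a nonzero vector in its left kernel, which is a
    nontrivial relation between the [v i]. *)
Lemma lin_indep_leq V n D (v : 'I_n -> V) (h : 'I_D -> V) (A : 'I_n -> 'I_D -> R[i]) :
  lin_indep v -> (forall i, v i = \sum_j A i j *: h j) -> (n <= D)%N.
Proof.
move=> vI vE; rewrite leqNgt; apply/negP => Dn.
pose M := \matrix_(i, j) A i j.
have : kermx M != 0.
  rewrite kermx_eq0 /row_free; apply/eqP => rM.
  by have := rank_leq_col M; rewrite rM leqNgt Dn.
move=> /rowV0Pn[c /sub_kermxP cM c0]; case/eqP: c0; apply/rowP => i; rewrite mxE.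
apply: (vI (fun i => c 0 i)); under eq_bigr do rewrite vE scaler_sumr.
rewrite exchange_big /= big1 // => j _.
under eq_bigr do rewrite scalerA.
rewrite -scaler_suml; move/rowP/(_ j): cM; rewrite !mxE => cM.
by under eq_bigr do [rewrite -[A _ _](mxE matrix_key (fun i j => A i j))]; rewrite cM scale0r.
Qed.

Lemma lin_indep_le_ldim V D (h : 'I_D -> V) (U : set V) :
  lin_indep h -> (forall i, U (h i)) -> ((D%:R : R)%:E <= ldim U)%E.
Proof. by move=> hI hU; apply: ereal_sup_ubound; exists D => //; exists h. Qed.

Lemma ldim_le V D (h : 'I_D -> V) (U : set V) :
  (forall v, U v -> exists c : 'I_D -> R[i], v = \sum_j c j *: h j) ->
  (ldim U <= (D%:R : R)%:E)%E.
Proof.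
move=> Uh; apply: ge_ereal_sup => _ [n [v [vU vI]] <-].
have /choice[A AE] : forall i, exists c : 'I_D -> R[i], v i = \sum_j c j *: h j.
  by move=> i; exact: Uh.
by rewrite lee_fin ler_nat; exact: lin_indep_leq vI AE.
Qed.

Lemma ldim_subset V (U U' : set V) : U `<=` U' -> (ldim U <= ldim U')%E.
Proof.
move=> UU'; apply: ge_ereal_sup => _ [n [v [vU vI]] <-].
by apply: (lin_indep_le_ldim vI) => i; exact: UU'.
Qed.

Lemma ldim_ge0 V (U : set V) : (0 <= ldim U)%E.
Proof.
by apply: (@lin_indep_le_ldim V 0 (fun=> 0)) => [c _ []|[]].
Qed.

Lemma oprank0 V W : oprank (fun _ : V => 0 : W) = 0%E.
Proof.
apply/eqP; rewrite eq_le ldim_ge0 andbT.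
by apply: (@ldim_le W 0 (fun=> 0)) => _ [v _ <-]; exists (fun=> 0); rewrite big_ord0.
Qed.

(** Greedy choice: the new vector is dropped if it lies in the span of those kept, and added
    otherwise. The coefficients [A] are returned so that sums over [g] can be regrouped over [h]. *)
Lemma basis_extraction V m (g : 'I_m -> V) :
  exists D (h : 'I_D -> V) (A : 'I_m -> 'I_D -> R[i]),
  [/\ lin_indep h, forall i, exists j, h i = g j & forall j, g j = \sum_i A j i *: h i].
Proof.
elim: m g => [|m IH] g.
  exists 0%N, (fun=> 0), (fun _ _ => 0).
  by split; [move=> c _ []|case|case].
have [D [h [A [hI hg gE]]]] := IH (fun j => g (lift ord0 j)).
have [[c gc]|Ng] := pselect (exists c : 'I_D -> R[i], g ord0 = \sum_i c i *: h i).
  exists D, h, (fun j => if unlift ord0 j is Some j' then A j' else c); split=> //.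
    by move=> i; have [j ->] := hg i; exists (lift ord0 j).
  by move=> j; case: unliftP => [j' ->|->].
exists D.+1, (fun i => if unlift ord0 i is Some i' then h i' else g ord0).
exists (fun j i => if unlift ord0 j is Some j' then
  if unlift ord0 i is Some i' then A j' i' else 0 else (i == ord0)%:R); split.
- move=> c; rewrite big_ord_recl unlift_none.
  under eq_bigr do rewrite liftK; move=> c0.
  (* Otherwise the relation could be solved for [g ord0], against [Ng]. *)
  have cz : c ord0 = 0.
    apply: contrapT => /eqP cN; apply: Ng; exists (fun i => - (c ord0)^-1 * c (lift ord0 i)).
    under eq_bigr do rewrite mulNr scaleNr -scalerA.
    rewrite sumrN -scaler_sumr; apply: (scalerI cN).
    rewrite scalerN scalerA divff // scale1r; apply/eqP.
    by rewrite -subr_eq0 opprK c0.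
  move: c0; rewrite cz scale0r add0r => /hI ch i.
  by case: (unliftP ord0 i) => [i' ->|->].
- move=> i; case: unliftP => [i' _|_]; last by exists ord0.
  by have [j ->] := hg i'; exists (lift ord0 j).
- move=> j; rewrite big_ord_recl unlift_none; case: unliftP => [j' ->|->].
    by rewrite scale0r add0r gE; apply: eq_bigr => i _; rewrite liftK.
  rewrite eqxx scale1r big1 ?addr0 // => i _.
  by rewrite eq_sym (negbTE (neq_lift _ _)) scale0r.
Qed.

(** Writing the [g j] in a basis [h] extracted from them gives [F u = \sum_i B (h i) u *: (\sum_j A
    j i *: w j)], so the range is spanned by as many vectors as [h] has terms. *)
Lemma oprank_separated V V' W m (F : V -> W) (B : V' -> V -> R[i])
    (g : 'I_m -> V') (w : 'I_m -> W) (U : set V') :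
  (forall u n (c : 'I_n -> R[i]) (h : 'I_n -> V'),
    B (\sum_i c i *: h i) u = \sum_i c i * B (h i) u) ->
  (forall u, F u = \sum_j B (g j) u *: w j) -> (forall j, U (g j)) ->
  (oprank F <= ldim U)%E.
Proof.
move=> Blin FE gU; have [D [h [A [hI hg gE]]]] := basis_extraction g.
apply: (@le_trans _ _ (D%:R%:E)); last first.
  by apply: lin_indep_le_ldim hI _ => i; have [j ->] := hg i.
apply: (ldim_le (h := fun i => \sum_j A j i *: w j)) => _ [u _ <-].
exists (fun i => B (h i) u); rewrite FE.
under eq_bigr do rewrite gE Blin scaler_suml.
rewrite exchange_big /=; apply: eq_bigr => i _; rewrite scaler_sumr.
by apply: eq_bigr => j _; rewrite scalerA mulrC.
Qed.

(** [F] has trivial kernel on the range of [G], which is a subspace, and so carries independent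
    vectors of that range to independent vectors. *)
Lemma oprank_le_of_injective V W V' (G : V -> V') (F : V' -> W) :
  linear G -> linear F -> (forall u, F (G u) = 0 -> G u = 0) ->
  (oprank G <= oprank F)%E.
Proof.
move=> Glin Flin FG; apply: ge_ereal_sup => _ [n [v [vG vI]] <-].
have sumE (V1 V2 : lmodType R[i]) (L : V1 -> V2) : linear L ->
    forall (c : 'I_n -> R[i]) u, L (\sum_i c i *: u i) = \sum_i c i *: L (u i).
  move=> Llin c u; have L0 : L 0 = 0.
    by have := Llin (-1) 0 0; rewrite scaler0 addr0 scaleN1r addNr.
  by elim/big_rec2: _ => // i y1 y2 _ <-; rewrite Llin.
have /choice[s sE] : forall i, exists s, G s = v i.
  by move=> i; have [s _ <-] := vG i; exists s.
apply: (@lin_indep_le_ldim _ _ (fun i => F (v i))); last by move=> i; exists (v i).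
move=> c; rewrite -(sumE _ _ F) // => F0; apply: vI.
have vs : \sum_i c i *: v i = G (\sum_i c i *: s i).
  by rewrite sumE //; apply: eq_bigr => i _; rewrite sE.
by rewrite vs; apply: FG; rewrite -vs.
Qed.

(** Kernel operators are shown linear under integrability hypotheses on the kernel; the bundled map
    is built from the proof of linearity when one is called for. *)
Lemma linear_fun_exists V W (F : V -> W) : linear F ->
  exists G : {linear V -> W}, (G : V -> W) = F.
Proof.
move=> Flin; pose m := GRing.isLinear.Build R[i] V W _ F Flin.
by exists (HB.pack_for {linear V -> W} F m).
Qed.

End finite_rank.

Section spectral_counting.
Context d1 d2 (X : measurableType d1) (Y : measurableType d2) (R : realType).
Variables (mu : {measure set X -> \bar R}) (nu : {measure set Y -> \bar R}).

(* The scalar spectral measure of such a [u] is carried by ]eps, 1 - eps[, so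
   <S u, u> > eps |u|^2 unless [u = 0]. *)
Lemma spectral_range_eq0 (S : L2 mu -> L2 mu) E (eps : R) (u : L2 mu) :
  spectral_measure S E -> E `]eps, (1 - eps)[%classic u = u ->
  complex.Re (inner (S u) u) <= eps * sqn u -> u = 0.
Proof.
move=> [_ ET _ Em]; set A : set (measurableTypeR R) := `]eps, (1 - eps)[%classic.
move=> EA Su; have [m [mE it SuE]] := Em u.
have mA : measurable A by exact: measurable_itv.
have mAE : m A = (sqn u)%:E by rewrite mE // EA inner_self.
have mTE : m setT = (sqn u)%:E by rewrite mE // ET inner_self.
(* [A] already carries the whole mass, which is finite. *)
have mCA : m (~` A) = 0%E.
  have : (m setT = m A + m (~` A))%E.
    by rewrite -measureU ?setUCr ?setICr //; exact: measurableC.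
  rewrite mTE mAE; case: (m (~` A)) => // r /eqP.
  by rewrite -EFinD eqe -subr_eq0 opprD addrA subrr add0r oppr_eq0 => /eqP ->.
move: Su; rewrite SuE /= /Rintegral => Su.
have iA : m.-integrable A (fun t => t%:E) by exact: integrableS it.
have ic : m.-integrable A (cst eps%:E).
  apply/integrableP; split; first exact: measurable_cst.
  by rewrite integral_cst // mAE -EFinM ltry.
have IA : (\int[m]_t t%:E = \int[m]_(t in A) t%:E)%E.
  rewrite (negligible_integral (measurableC mA) _ _ mCA) //.
  by rewrite setTD setCK.
have absE : (\int[m]_(t in A) `|t%:E - eps%:E| = \int[m]_(t in A) (t%:E - eps%:E))%E.
  apply: eq_integral => t At.
  have /andP[et _] : eps < t < 1 - eps by move/set_mem: At; rewrite /A /= in_itv.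
  by rewrite gee0_abs // -EFinB lee_fin subr_ge0 ltW.
have subE : (\int[m]_(t in A) (t%:E - eps%:E) = \int[m]_t t%:E - eps%:E * m A)%E.
  by rewrite (integralB mA iA ic) integral_cst // -IA.
(* On [A] the function [t - eps] is positive, yet by [Su] its integral is at most
   [eps * sqn u - eps * m A = 0]. *)
have f0 : (\int[m]_(t in A) `|t%:E - eps%:E| = 0)%E.
  apply/eqP; rewrite eq_le integral_ge0 // andbT absE subE mAE.
  rewrite -(fineK (integrable_fin_num measurableT it)).
  by rewrite -EFinM -EFinB lee_fin subr_le0.
have mf : measurable_fun A (fun t : R => (t%:E - eps%:E)%E).
  by apply: emeasurable_funB; [exact: (measurable_int m)|exact: measurable_cst].
have /(ae_eq_integral_abs m mA mf) := f0.
move=> [N [mN mN0 AN]]; apply: sqn_eq0.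
(* Almost everywhere on [A] one has [t = eps], but the interval is open at [eps]. *)
have : m A = 0%E.
  apply: (subset_measure0 mA mN) => // t At; apply: AN => /(_ At) /eqP.
  rewrite -EFinB eqe subr_eq0 => /eqP te.
  by move: At; rewrite /A /= in_itv /= te ltxx.
by rewrite mAE => -[].
Qed.

Lemma Lambda_le_oprank (S : L2 mu -> L2 mu) (K F : L2 mu -> L2 nu) (eps : R) :
  linear F -> (forall u, complex.Re (inner (S u) u) <= sqn (K u)) ->
  (forall u, F u = 0 -> sqn (K u) <= eps * sqn u) ->
  (Lambda eps S <= oprank F)%E.
Proof.
move=> Flin SK KF; rewrite /Lambda /spectral_projection.
(* The default value of [xget] is the zero map, of rank 0. *)
case: xgetP => [P _ [E SE PE]|_]; last by rewrite oprank0 ldim_ge0.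
have [EP _ _ _] := SE.
have [Plin PP _] : orth_projection P by rewrite PE; apply: EP; exact: measurable_itv.
apply: oprank_le_of_injective => // u FPu; apply: (spectral_range_eq0 (eps := eps) SE).
  by move: (PP u); rewrite {1}PE.
by rewrite (le_trans (SK _)) // KF.
Qed.

(** For a genuine adjoint this is the equality [<K*K u, u> = |K u|^2]; for the default value 0 of
    [adjoint] the left side is 0. The inequality covers both. *)
Lemma Re_inner_adjoint_le (K : L2 mu -> L2 nu) u :
  complex.Re (inner ((adjoint K \o K) u) u) <= sqn (K u).
Proof.
rewrite /comp /adjoint; case: xgetP => [G _ GE|_]; last by rewrite inner0l sqn_ge0.
have {}GE v w : inner (K v) w = inner v (G w) := GE v w.
by rewrite (innerC u (G (K u))) -GE inner_self conjc_real.
Qed.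

End spectral_counting.

(** * Approximation of the kernel *)

Section product_approximation.
Context (R : realType).

(** The sum [Delta_ s] for the identity permutation; the other permutations are reached by
    reindexing [dl] and [q]. *)
Definition telescoped r (dl q : 'I_r -> R) : R :=
  \sum_(j < r) dl j * \prod_(h < r | (h < j)%N) q h.

Lemma telescopedS r (dl q : 'I_r.+1 -> R) :
  telescoped dl q =
    telescoped (fun j : 'I_r => dl (widen_ord (leqnSn r) j))
               (fun j : 'I_r => q (widen_ord (leqnSn r) j)) +
    dl ord_max * \prod_(h < r) q (widen_ord (leqnSn r) h).
Proof.
rewrite /telescoped big_ord_recr /=; congr (_ + _ * _).
  apply: eq_bigr => j _; congr (_ * _).
  by rewrite big_mkcond big_ord_recr /= ltnNge ltnW ?mulr1 //= -big_mkcond.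
rewrite big_mkcond big_ord_recr /= ltnn mulr1.
by apply: eq_bigr => h _; rewrite ltn_ord.
Qed.

(** With the last factors [u], [v] split off, [U u - V v = (U - V) u + V (u - v)]: an exact factor
    has modulus at most 1 and does not amplify the earlier error, while the new error is multiplied
    by the bounds on the factors already replaced. *)
Lemma cabs_prodB_le r (u v : 'I_r -> R[i]) (dl q : 'I_r -> R) :
  (forall l, cabs (u l) <= 1) -> (forall l, cabs (v l) <= q l) ->
  (forall l, cabs (u l - v l) <= dl l) ->
  cabs (\prod_l u l - \prod_l v l) <= telescoped dl q.
Proof.
elim: r u v dl q => [|r IH] u v dl q u1 vq uv.
  by rewrite !big_ord0 subrr cabs0 /telescoped big_ord0.
rewrite telescopedS !big_ord_recr /=.
set U := \prod_(i < r) u _; set V := \prod_(i < r) v _.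
rewrite (_ : _ - _ = (U - V) * u ord_max + V * (u ord_max - v ord_max)); last by ring.
apply: (le_trans (ler_cabsD _ _)); rewrite !cabsM; apply: lerD.
  rewrite -[leRHS]mulr1; apply: ler_pM; rewrite ?cabs_ge0 //.
  exact: IH.
rewrite mulrC; apply: ler_pM; rewrite ?cabs_ge0 // cabs_prod.
by apply: ler_prod => i _; rewrite cabs_ge0 vq.
Qed.

(** With every [q] raised to [1 + dl] the sum telescopes exactly:
    [W (1 + dl) - 1 = (W - 1) + dl W]. *)
Lemma telescoped_le r (dl q : 'I_r -> R) :
  (forall l, 0 <= dl l) -> (forall l, 0 <= q l <= 1 + dl l) ->
  telescoped dl q <= \prod_l (1 + dl l) - 1.
Proof.
elim: r dl q => [|r IH] dl q d0 q1; first by rewrite /telescoped !big_ord0 subrr.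
rewrite telescopedS big_ord_recr /=.
set W := \prod_(i < r) (1 + _).
rewrite (_ : _ - 1 = (W - 1) + dl ord_max * W); last by ring.
by apply: lerD; [exact: IH|apply: ler_wpM2l => //; exact: ler_prod].
Qed.

(** Ensures that the sets below are bounded, so that their real [sup] is an upper bound. *)
Lemma cabs_horner_bounded (P : {poly R[i]}) (M : R) :
  exists B, forall t, `|t| <= M -> cabs P.[t%:C%C] <= B.
Proof.
exists (\sum_(i < size P) cabs P`_i * M ^+ i) => t tM.
rewrite horner_coef (le_trans (ler_cabs_sum _ _ _)) //; apply: ler_sum => i _.
rewrite cabsM; apply: ler_wpM2l; first exact: cabs_ge0.
by rewrite -rmorphXn cabs_real normrX lerXn2r ?nnegrE // (le_trans _ tM).
Qed.

Section disc_sup.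
Variables (P : {poly R[i]}) (M : R).
Let delta := sup [set cabs (cexpi t - P.[t%:C%C]) | t in [set t : R | `|t| <= M]].
Let q := sup [set cabs P.[t%:C%C] | t in [set t : R | `|t| <= M]].

Lemma cabs_le_sup_horner t : `|t| <= M -> cabs P.[t%:C%C] <= q.
Proof.
move=> tM; apply: ub_le_sup; last by exists t.
have [B PB] := cabs_horner_bounded P M.
by exists B => _ [s sM <-]; exact: PB.
Qed.

Lemma cabs_le_sup_cexpiB t : `|t| <= M -> cabs (cexpi t - P.[t%:C%C]) <= delta.
Proof.
move=> tM; apply: ub_le_sup; last by exists t.
have [B PB] := cabs_horner_bounded P M.
exists (1 + B) => _ [s sM <-]; rewrite (le_trans (ler_cabsD _ _)) //.
by rewrite cabs_cexpi cabsN lerD2l PB.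
Qed.

Hypothesis M0 : 0 <= M.

Lemma sup_cexpiB_ge0 : 0 <= delta.
Proof. by apply: le_trans (cabs_le_sup_cexpiB (t := 0) _); rewrite ?cabs_ge0 // normr0. Qed.

Lemma sup_horner_ge0 : 0 <= q.
Proof. by apply: le_trans (cabs_le_sup_horner (t := 0) _); rewrite ?cabs_ge0 // normr0. Qed.

(** From [P = e^{it} - (e^{it} - P)] and [|e^{it}| = 1]. *)
Lemma sup_horner_le : q <= 1 + delta.
Proof.
apply: ge_sup; first by exists (cabs P.[0%:C%C]); exists 0; rewrite //= normr0.
move=> _ [t tM <-].
rewrite (_ : P.[_] = cexpi t + - (cexpi t - P.[t%:C%C])); last by rewrite opprB addrC subrK.
rewrite (le_trans (ler_cabsD _ _)) // cabs_cexpi cabsN lerD2l.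
exact: cabs_le_sup_cexpiB.
Qed.

End disc_sup.
End product_approximation.

(** * Null sets of the product and essential oscillation *)

Section product_ae.
Context d1 d2 (X : measurableType d1) (Y : measurableType d2) (R : realType).
Variables (mu : {sigma_finite_measure set X -> \bar R}).
Variables (nu : {sigma_finite_measure set Y -> \bar R}).

(** The cylinder over a null set has measure [0 * nu setT], which is 0 even when [nu] is
    infinite. *)
Lemma ae_fst (P : X -> Prop) :
  (\forall x \ae mu, P x) -> \forall xy \ae (mu \x nu)%E, P xy.1.
Proof.
move=> [N [mN N0 PN]]; exists (N `*` setT); split.
- exact: measurableX.
- apply: etrans (product_measure1E mu nu mN measurableT) _.
  by apply/eqP; rewrite mule_eq0; apply/orP; left; apply/eqP.
- by move=> xy /= Pxy; split => //; apply: PN.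
Qed.

Lemma ae_snd (P : Y -> Prop) :
  (\forall y \ae nu, P y) -> \forall xy \ae (mu \x nu)%E, P xy.2.
Proof.
move=> [N [mN N0 PN]]; exists (setT `*` N); split.
- exact: measurableX.
- apply: etrans (product_measure1E mu nu measurableT mN) _.
  by apply/eqP; rewrite mule_eq0; apply/orP; right; apply/eqP.
- by move=> xy /= Pxy; split => //; apply: PN.
Qed.

(** The norm ['N_+oo] is an essential supremum on spaces of positive measure, so the bounds on the
    two factors call for this. *)
Lemma product_measure_setT_gt0 :
  (0 < (mu \x nu) setT)%E -> (0 < mu setT)%E /\ (0 < nu setT)%E.
Proof.
have := product_measure1E mu nu measurableT measurableT.
rewrite setXTT => ->; have := measure_ge0 mu setT; have := measure_ge0 nu setT.
rewrite !le_eqVlt => /predU1P[<-|nu0] /predU1P[<-|mu0]; rewrite ?mule0 ?mul0e ?ltxx //.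
Qed.

End product_ae.

Section essential_bounds.
Context d (T : measurableType d) (R : realType).
Variable mu : {measure set T -> \bar R}.
Hypothesis mu_gt0 : (0 < mu setT)%E.
Implicit Type f : T -> R.

Lemma Lnormy_bounded f : ('N[mu]_+oo[EFin \o f] < +oo)%E ->
  exists B : R, \forall x \ae mu, `|f x| <= B.
Proof.
rewrite unlock /= mu_gt0 => fy.
exists (fine (ess_sup mu (abse \o (EFin \o f)))).
apply: filterS (ess_sup_ge mu (abse \o (EFin \o f))) => x /= fx.
have s0 : (0 <= ess_sup mu (abse \o (EFin \o f)))%E by apply: le_trans fx; rewrite lee_fin.
by rewrite -lee_fin fineK // ge0_fin_numE.
Qed.

Lemma ae_ex (P : T -> Prop) : (\forall x \ae mu, P x) -> exists x, P x.
Proof.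
move=> [N [mN N0 PN]]; apply: contrapT => nP.
have NT : N = setT by apply/seteqP; split=> // x _; apply: PN => Px; apply: nP; exists x.
by move: mu_gt0; rewrite -NT N0 ltxx.
Qed.

(** The two [fine] are meaningful once the essential bounds are known to be finite: one side comes
    from [B], the other from a point where the almost everywhere bounds hold, which exists because
    the measure is nonzero. *)
Lemma ess_oscillation f (B : R) : (\forall x \ae mu, `|f x| <= B) ->
  let s := fine (ess_sup mu (EFin \o f)) in
  let i := fine (ess_inf mu (EFin \o f)) in
  0 <= 2^-1 * (s - i) /\
  \forall x \ae mu, `|f x - 2^-1 * (s + i)| <= 2^-1 * (s - i).
Proof.
move=> fB s i.
have sE : ess_sup mu (EFin \o f) = s%:E.
  rewrite /s fineK //; apply/fin_numPlt/andP; split.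
    have [x /= [lx bx]] := ae_ex (filterI (ess_sup_ge mu (EFin \o f)) fB).
    by apply: lt_le_trans lx; rewrite ltNyr.
  apply: (@le_lt_trans _ _ B%:E); last exact: ltry.
  by apply/ess_supP; apply: filterS fB => x; rewrite ler_norml lee_fin => /andP[].
have iE : ess_inf mu (EFin \o f) = i%:E.
  rewrite /i fineK //; apply/fin_numPlt/andP; split.
    apply: (@lt_le_trans _ _ (- B)%:E); first exact: ltNyr.
    by apply/ess_infP; apply: filterS fB => x; rewrite ler_norml lee_fin => /andP[].
  have [x /= [lx bx]] := ae_ex (filterI (ess_inf_le mu (EFin \o f)) fB).
  by apply: le_lt_trans lx _; rewrite ltry.
have osc : \forall x \ae mu, i <= f x <= s.
  move: (ess_sup_ge mu (EFin \o f)) (ess_inf_le mu (EFin \o f)).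
  by apply: filterS2 => x; rewrite sE iE /= !lee_fin => -> ->.
split; first by have [x] := ae_ex osc; lra.
by apply: filterS osc => x fx; rewrite ler_norml; lra.
Qed.

End essential_bounds.

Section spans.
Context (R : realType) (V : lmodType R[i]).

Lemma sub_lspan (A : set V) : A `<=` lspan A.
Proof.
move=> u Au; exists 1%N, (fun=> 1), (fun=> u); split=> //.
by rewrite big_ord1 scale1r.
Qed.

Lemma lspan_sum (I : finType) (P : {pred I}) (A : set V) (c : I -> R[i]) (u : I -> V) :
  (forall i, i \in P -> A (u i)) -> lspan A (\sum_(i in P) c i *: u i).
Proof.
move=> Au; exists #|P|, (fun k => c (enum_val k)), (fun k => u (enum_val k)); split.
  by move=> k; apply: Au; exact: enum_valP.
by rewrite big_enum_val.
Qed.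

Lemma ldim_lspan_le (I : finType) (P : {pred I}) (A : set V) (g : I -> V) :
  (forall v, A v -> exists2 i, i \in P & v = g i) ->
  (ldim (lspan A) <= (#|P|%:R : R)%:E)%E.
Proof.
move=> Ag; apply: (ldim_le (h := fun k : 'I_#|P| => g (enum_val k))).
move=> _ [n [c [u [uA ->]]]].
have /choice[s sP] : forall i, exists k : 'I_#|P|, u i = g (enum_val k).
  move=> i; have [j jP ->] := Ag _ (uA i).
  by exists (enum_rank_in jP j); rewrite enum_rankK_in.
(* A combination may use the same generator several times; its coefficients are added up. *)
exists (fun k => \sum_(i | s i == k) c i).
under [RHS]eq_bigr do rewrite scaler_suml.
rewrite (exchange_big_dep xpredT) //=; apply: eq_bigr => i _.
by rewrite (eq_bigl (pred1 (s i))) ?big_pred1_eq ?sP // => k; rewrite /= eq_sym.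
Qed.

End spans.

(** * Kernels with separated variables and their rank *)

Section separated_kernels.
Context d1 d2 (X : measurableType d1) (Y : measurableType d2) (R : realType).
Variables (mu : {sigma_finite_measure set X -> \bar R}).
Variables (nu : {sigma_finite_measure set Y -> \bar R}).
Variables (I : finType) (P : {pred I}) (c : I -> R[i]).
Variables (G : I -> X -> R[i]) (H : I -> Y -> R[i]).
Hypothesis sG : forall i, i \in P -> square_integrable mu (G i).
Hypothesis sH : forall i, i \in P -> square_integrable nu (H i).

Let k (xy : X * Y) := \sum_(i in P) c i * (G i xy.1 * H i xy.2).
(** The kernel pairs [G i] with [u] bilinearly, while [inner] is conjugate-linear in its second
    argument; conjugating [u] reconciles them. *)
Let L2conj (u : L2 mu) : L2 mu := toL2 mu (fun x => conjc (u x)).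

Lemma cintegral_inner (f : X -> R[i]) (u : L2 mu) : square_integrable mu f ->
  cintegral mu (fun x => f x * u x) = inner (toL2 mu f) (L2conj u).
Proof.
move=> sf; have su := L2_square_integrable u; have sJ := square_integrableJ su.
apply: ae_eq_cintegral.
- by apply: cmeasurableM; [exact: (proj1 sf)|exact: L2_cmeasurable].
- exact: inner_cmeasurable.
- move: (toL2_ae sf) (toL2_ae sJ); apply: filterS2 => x fx ux _.
  by rewrite /L2conj fx ux conjcK.
Qed.

Lemma kernel_op_separated u :
  kernel_op nu k u =
  \sum_(i in P) inner (toL2 mu (G i)) (L2conj u) *: (c i *: toL2 nu (H i)).
Proof.
have su := L2_square_integrable u.
under eq_bigr do rewrite scalerA.
rewrite -toL2_sum //; congr toL2; apply/funext => y; rewrite /kernel_fun /k /=.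
under eq_fun do rewrite mulr_suml.
(* Outside [P] nothing is known of [G i]; replacing it by 0 there makes every term integrable, as
   [cintegral_sum] asks. *)
pose F i x := (c i * H i y) * ((if i \in P then G i x else 0) * u x).
rewrite (_ : (fun _ => _) = fun x => \sum_(i in P) F i x); last first.
  by apply/funext => x; apply: eq_bigr => i iP; rewrite /F iP; ring.
have iGu i : cintegrable mu (fun x => (if i \in P then G i x else 0) * u x).
  case iP: (i \in P); first by apply: cintegrableM => //; exact: sG.
  by under eq_fun do rewrite mul0r; exact: cintegrable0.
rewrite cintegral_sum; last by move=> i; exact: cintegrableZ.
apply: eq_bigr => i iP; rewrite cintegralZ // iP cintegral_inner; last exact: sG.
by ring.
Qed.

(** The range lies in the span of the [H i], whence the bound by [B]; the bound by [A] holds because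
    [u] enters only through pairings linear in the [G i]. *)
Lemma oprank_separated_kernel (A : set (L2 mu)) (B : set (L2 nu)) :
  (forall i, i \in P -> A (toL2 mu (G i))) ->
  (forall i, i \in P -> B (toL2 nu (H i))) ->
  (oprank (kernel_op nu k : L2 mu -> L2 nu) <= Order.min (ldim (lspan A)) (ldim (lspan B)))%E.
Proof.
move=> AG BH; rewrite le_min; apply/andP; split.
  apply: (oprank_separated (B := fun g u => inner g (L2conj u))
    (g := fun j : 'I_#|P| => toL2 mu (G (enum_val j)))
    (w := fun j : 'I_#|P| => c (enum_val j) *: toL2 nu (H (enum_val j)))).
  - move=> u n a h; rewrite inner_suml.
    by apply: eq_bigr => i _; rewrite innerZl.
  - by move=> u; rewrite kernel_op_separated big_enum_val.
  - by move=> j; apply/sub_lspan/AG; exact: enum_valP.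
apply: ldim_subset => _ [u _ <-]; rewrite kernel_op_separated.
by under eq_bigr do rewrite scalerA; exact: lspan_sum.
Qed.

End separated_kernels.

Section box_functions.
Context d (T : measurableType d) (R : realType).
Variable mu : {measure set T -> \bar R}.

Lemma box_square_integrable r (f : T -> R[i]) (phi0 : T -> R) (Z : 'I_r -> T -> R)
    (k : 'I_r -> nat) : square_integrable mu f ->
  measurable_fun setT phi0 -> (forall l, measurable_fun setT (Z l)) ->
  (forall l, exists B : R, \forall x \ae mu, `|Z l x| <= B) ->
  square_integrable mu
    (fun x => f x * cexpi (phi0 x) * (\prod_l Z l x ^+ k l)%:C%C).
Proof.
move=> sf mphi mZ /choice[B ZB].
apply: (@ae_le_square_integrable _ _ _ _ (\prod_l B l ^+ k l) f) => //.
  apply: cmeasurableM.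
    by apply: cmeasurableM; [exact: (proj1 sf)|exact: cmeasurable_cexpi].
  apply: cmeasurable_real; apply: measurable_prod => l _.
  exact: measurable_funX.
have ZBl : \forall x \ae mu, forall l, `|Z l x| <= B l.
  exact: (@filter_forall _ _ (fun l x => `|Z l x| <= B l) _ _ ZB).
apply: filterS ZBl => x ZBx.
rewrite !cabsM cabs_cexpi mulr1 cabs_real mulrC normr_prod.
apply: ler_wpM2r; first exact: cabs_ge0.
apply: ler_prod => l _; rewrite normr_ge0 normrX /=.
by rewrite lerXn2r ?nnegrE // (le_trans _ (ZBx l)).
Qed.

End box_functions.

Section polynomial_expansion.
Context (R : realType) (r n : nat) (N : 'I_r -> nat).
Hypothesis Nn : forall l, (N l <= n)%N.

Let below l : pred 'I_n := fun j => (j < N l)%N.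

(** The factors have different degree bounds. Multi-indices are functions into one type ['I_n] with
    [n] above every [N l], cut down to a family, so that distributivity over finite functions
    applies. *)
Lemma prod_horner_expand (Q : 'I_r -> {poly R[i]}) (s t : 'I_r -> R) :
  (forall l, (size (Q l) <= N l)%N) ->
  \prod_l (Q l).[(s l * t l)%:C%C] =
  \sum_(f : {ffun 'I_r -> 'I_n} | f \in family below) (\prod_l (Q l)`_(f l)) *
    ((\prod_l s l ^+ f l)%:C%C * (\prod_l t l ^+ f l)%:C%C).
Proof.
move=> sQ.
have QE l : (Q l).[(s l * t l)%:C%C] =
    \sum_(j < n | below l j) (Q l)`_j * (s l ^+ j * t l ^+ j)%:C%C.
  rewrite (horner_coef_wide _ (sQ l)).
  under eq_bigr do rewrite -rmorphXn exprMn.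
  by rewrite (big_ord_widen n (fun j => (Q l)`_j * (s l ^+ j * t l ^+ j)%:C%C)).
under eq_bigr do rewrite QE.
rewrite bigA_distr_big_dep; apply: eq_bigr => f _.
by rewrite big_split /= -rmorphM -rmorph_prod -big_split.
Qed.

Lemma card_multi_indices : #|family below : {pred {ffun 'I_r -> 'I_n}}| = (\prod_l N l)%N.
Proof.
rewrite card_family foldrE big_map big_enum /=; apply: eq_bigr => l _.
rewrite -sum1_card -[RHS]card_ord -sum1_card.
by rewrite (big_ord_widen n (fun=> 1%N)).
Qed.

End polynomial_expansion.

(** * The theorem *)

Theorem theorem7p7 (R : realType) (d1 d2 : measure_display)
  (X : measurableType d1) (Y : measurableType d2)
  (mu : {sigma_finite_measure set X -> \bar R})
  (nu : {sigma_finite_measure set Y -> \bar R})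
  (p r : nat) (p_ge1 : (1 <= p)%N) (r_ge1 : (1 <= r)%N)
  (wX : X -> R[i]) (a : 'I_p -> X -> R[i])
  (wY : Y -> R[i]) (b : 'I_p -> Y -> R[i])
  (phi : X -> R) (Xs : 'I_r -> X -> R)
  (psi : Y -> R) (Ys : 'I_r -> Y -> R)
  (mwX : cmeasurable wX) (ma : forall q, cmeasurable (a q))
  (mwY : cmeasurable wY) (mb : forall q, cmeasurable (b q))
  (wXa_L2 : forall q, square_integrable mu (fun x => wX x * a q x))
  (wYb_L2 : forall q, square_integrable nu (fun y => wY y * b q y))
  (mphi : measurable_fun setT phi) (mXs : forall l, measurable_fun setT (Xs l))
  (mpsi : measurable_fun setT psi) (mYs : forall l, measurable_fun setT (Ys l))
  (xi eta : 'I_r -> R) (N : 'I_r -> nat) (P : 'I_r -> {poly R[i]}) :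
  let K : L2 mu -> L2 nu := interaction_op nu wX a wY b phi psi Xs Ys in
  let Xt l x := Xs l x - xi l in
  let Yt l y := Ys l y - eta l in
  let C := L2norm (mu \x nu)%E
    (fun xy => wX xy.1 * wY xy.2 * amplitude a b xy.1 xy.2) in
  let phi0 x := phi x + \sum_l eta l * Xs l x - \sum_l xi l * eta l in
  let psi0 y := psi y + \sum_l xi l * Ys l y in
  let z l (xy : X * Y) := Xt l xy.1 * Yt l xy.2 in
  let M l := 2^-1 * (fine (ess_sup (mu \x nu)%E (EFin \o z l))
                     - fine (ess_inf (mu \x nu)%E (EFin \o z l))) in
  let d : \bar R := Order.min (ldim (box_space mu N wX a phi0 Xt))
                     (ldim (box_space nu N wY b psi0 Yt)) in
  let delta l := sup [set cabs (cexpi t - (P l).[t%:C%C]) |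
                       t in [set t : R | `|t| <= M l]] in
  let q l := sup [set cabs (P l).[t%:C%C] | t in [set t : R | `|t| <= M l]] in
  let Delta_ (s : {perm 'I_r}) : R :=
    \sum_(j < r) delta (s j) * \prod_(h < r | (h < j)%N) q (s h) in
  let Delta : R := \big[Order.min/Delta_ 1%g]_(s : {perm 'I_r}) Delta_ s in
  let err := (C * (Order.min 1 (\prod_l (1 + delta l) - 1))%:E)%E in
  (forall l, 'N[mu]_+oo[EFin \o Xt l] < +oo)%E ->
  (forall l, 'N[nu]_+oo[EFin \o Yt l] < +oo)%E ->
  (C < +oo)%E ->
  (0 < (mu \x nu) setT)%E ->
  (forall l, (1 <= N l)%N) ->
  (forall l, (size (P l) <= N l)%N) ->
  [/\ exists K' : {linear L2 mu -> L2 nu},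
        [/\ (oprank K' <= d)%E,
            (opnorm (K \- K')%R <= HSnorm (K \- K')%R)%E &
            (HSnorm (K \- K')%R <= C * Delta%:E)%E],
      forall l, q l <= 1 + delta l,
      Delta <= \prod_l (1 + delta l) - 1,
      exists K' : {linear L2 mu -> L2 nu},
        [/\ (oprank K' <= d)%E,
            (opnorm (K \- K')%R <= HSnorm (K \- K')%R)%E &
            (HSnorm (K \- K')%R <= err)%E] &
      forall eps : R, (opnorm K <= 1)%E -> 0 < eps < 2^-1 ->
        (err <= (Num.sqrt eps)%:E)%E ->
        (Lambda eps (adjoint K \o K) <= d)%E /\
        (d <= (p * \prod_l N l)%N%:R%:E)%E].
Proof.
move=> K Xt Yt C phi0 psi0 z M d delta q Delta_ Delta err hX hY hC hmu hN hP.
have [muX0 nuY0] := product_measure_setT_gt0 hmu.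
have XB l := Lnormy_bounded muX0 (hX l).
have YB l := Lnormy_bounded nuY0 (hY l).
pose c l := 2^-1 * (fine (ess_sup (mu \x nu)%E (EFin \o z l))
                     + fine (ess_inf (mu \x nu)%E (EFin \o z l))).
have zosc l : 0 <= M l /\ \forall xy \ae (mu \x nu)%E, `|z l xy - c l| <= M l.
  have [BX XBl] := XB l; have [BY YBl] := YB l.
  apply: (@ess_oscillation _ _ _ _ hmu (z l) (BX * BY)).
  move: (ae_fst nu XBl) (ae_snd mu YBl); apply: filterS2 => xy Xle Yle.
  by rewrite normrM ler_pM.
have M0 l : 0 <= M l by case: (zosc l).
have zM : \forall xy \ae (mu \x nu)%E, forall l, `|z l xy - c l| <= M l.
  by apply: (@filter_forall _ _ (fun l xy => `|z l xy - c l| <= M l)) => l; case: (zosc l).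
have mXt l : measurable_fun setT (Xt l) by apply: measurable_funB.
have mYt l : measurable_fun setT (Yt l) by apply: measurable_funB.
have mphi0 : measurable_fun setT phi0.
  apply: measurable_funB => //; apply: measurable_funD => //.
  by apply: measurable_sum => l; exact: measurable_funM.
have mpsi0 : measurable_fun setT psi0.
  by apply: measurable_funD => //; apply: measurable_sum => l; exact: measurable_funM.
pose A xy := wX xy.1 * wY xy.2 * amplitude a b xy.1 xy.2.
pose T0 xy := cexpi (phi0 xy.1) * cexpi (psi0 xy.2).
(* [kE] is the kernel under the integral sign, where [wY] does not appear; square-integrability is
   available for [k]. *)
pose kE xy := wX xy.1 * amplitude a b xy.1 xy.2 *
  cexpi (phi xy.1 + psi xy.2 + \sum_l Xs l xy.1 * Ys l xy.2).
pose k xy := wY xy.2 * kE xy.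
have m1 f : cmeasurable f -> cmeasurable (fun xy : X * Y => f xy.1 : R[i]).
  exact: cmeasurable_comp measurable_fst.
have m2 f : cmeasurable f -> cmeasurable (fun xy : X * Y => f xy.2 : R[i]).
  exact: cmeasurable_comp measurable_snd.
have mamp : cmeasurable (fun xy : X * Y => amplitude a b xy.1 xy.2).
  by apply: cmeasurable_sum => j; apply: cmeasurableM; [exact: m1|exact: m2].
have mA : cmeasurable A.
  by apply: cmeasurableM => //; apply: cmeasurableM; [exact: m1|exact: m2].
have sA : square_integrable (mu \x nu)%E A by split.
have mkE : cmeasurable kE.
  apply: cmeasurableM; first by apply: cmeasurableM => //; exact: m1.
  apply: cmeasurable_cexpi; apply: measurable_funD.
    by apply: measurable_funD; apply: measurableT_comp.
  by apply: measurable_sum => l; apply: measurable_funM; apply: measurableT_comp.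
have mk : cmeasurable k by apply: cmeasurableM => //; exact: m2.
have cabsk xy : cabs (k xy) = cabs (A xy).
  by rewrite /k /kE /A !cabsM cabs_cexpi; ring.
have sk : square_integrable (mu \x nu)%E k.
  apply: (@ae_le_square_integrable _ _ _ _ 1 A) => //.
  by apply: aeW => xy; rewrite cabsk mul1r.
(* Since [X_l Y_l = z_l + eta_l X_l + xi_l Y_l - xi_l eta_l], the last three terms are exactly what
   [phi0] and [psi0] absorb. *)
have kprod xy : k xy = A xy * T0 xy * \prod_l (cexpi (c l) * cexpi (z l xy - c l)).
  under eq_bigr do rewrite -cexpiD addrC subrK.
  rewrite -cexpi_sum /k /kE /A /T0.
  rewrite (_ : phi _ + _ + _ = phi0 xy.1 + psi0 xy.2 + \sum_l z l xy).
    by rewrite !cexpiD; ring.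
  rewrite /phi0 /psi0 /z /Xt /Yt.
  have -> : \sum_l (Xs l xy.1 - xi l) * (Ys l xy.2 - eta l) =
      \sum_l Xs l xy.1 * Ys l xy.2 - \sum_l eta l * Xs l xy.1
        - \sum_l xi l * Ys l xy.2 + \sum_l xi l * eta l.
    by rewrite -!sumrB -big_split /=; apply: eq_bigr => l _; ring.
  by ring.
pose Q l := cexpi (c l) *: (P l \Po ('X - ((c l)%:C%C)%:P)).
have QE l t : (Q l).[t%:C%C] = cexpi (c l) * (P l).[(t - c l)%:C%C].
  by rewrite /Q hornerZ horner_comp hornerXsubC rmorphB.
have sQ l : (size (Q l) <= N l)%N.
  apply: leq_trans (size_scale_leq _ _) _.
  by rewrite size_comp_poly2 ?size_XsubC.
pose k' xy := A xy * T0 xy * \prod_l (Q l).[(z l xy)%:C%C].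
pose n := \max_l N l.
have Nn l : (N l <= n)%N by exact: (leq_bigmax l).
pose F : {pred {ffun 'I_r -> 'I_n}} := family (fun l (j : 'I_n) => (j < N l)%N).
pose I0 : {pred 'I_p * {ffun 'I_r -> 'I_n}} := [pred i | i.2 \in F].
pose G (i : 'I_p * {ffun 'I_r -> 'I_n}) x :=
  wX x * a i.1 x * cexpi (phi0 x) * (\prod_l Xt l x ^+ i.2 l)%:C%C.
pose H (i : 'I_p * {ffun 'I_r -> 'I_n}) y :=
  wY y * b i.1 y * cexpi (psi0 y) * (\prod_l Yt l y ^+ i.2 l)%:C%C.
pose al (i : 'I_p * {ffun 'I_r -> 'I_n}) := \prod_l (Q l)`_(i.2 l).
have sG i : square_integrable mu (G i).
  exact: (box_square_integrable (fun l => i.2 l : nat) (wXa_L2 i.1) mphi0 mXt XB).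
have sH i : square_integrable nu (H i).
  exact: (box_square_integrable (fun l => i.2 l : nat) (wYb_L2 i.1) mpsi0 mYt YB).
have k'E : k' = fun xy => \sum_(i in I0) al i * (G i xy.1 * H i xy.2).
  apply/funext => xy; rewrite /k' (prod_horner_expand Nn _ _ sQ).
  rewrite /A /T0 /amplitude mulr_sumr !mulr_suml.
  under eq_bigr do rewrite mulr_sumr.
  rewrite pair_big /=; apply: eq_bigr => -[j f] _.
  by rewrite /al /G /H /=; ring.
have mk' : cmeasurable k'.
  rewrite k'E; apply: cmeasurable_sum => i.
  apply: cmeasurableM; first exact: cmeasurable_cst.
  by apply: cmeasurableM; [exact: m1 (proj1 (sG i))|exact: m2 (proj1 (sH i))].
have delta0 l : 0 <= delta l by exact: sup_cexpiB_ge0.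
have q0 l : 0 <= q l by exact: sup_horner_ge0.
have qle l : q l <= 1 + delta l by exact: sup_horner_le.
have Delta_ge0 s : 0 <= Delta_ s.
  apply: sumr_ge0 => j _; apply: mulr_ge0 => //.
  by apply: prodr_ge0.
(* The default of the iterated minimum is itself one of the [Delta_ s]. *)
have Delta0 : 0 <= Delta by apply: le_bigmin => // s _.
have DeltaE : Delta <= \prod_l (1 + delta l) - 1.
  apply: (@le_trans _ _ (Delta_ 1%g)); first exact: bigmin_le_id.
  have -> : Delta_ 1%g = telescoped delta q.
    by rewrite /Delta_; under eq_bigr do [rewrite perm1; under eq_bigr do rewrite perm1].
  by apply: telescoped_le => // l; rewrite q0 qle.
pose dk xy := k xy - k' xy.
have dkA : \forall xy \ae (mu \x nu)%E, cabs (dk xy) <= Delta * cabs (A xy).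
  apply: filterS zM => xy zMxy; rewrite /dk kprod /k' -mulrBr cabsM mulrC.
  rewrite [X in _ * X]cabsM /T0 cabsM !cabs_cexpi !mulr1.
  apply: ler_wpM2r; first exact: cabs_ge0.
  (* Reordering both products by [s] leaves them unchanged but alters the telescoping bound. *)
  have le_s s : cabs (\prod_l (cexpi (c l) * cexpi (z l xy - c l))
      - \prod_l (Q l).[(z l xy)%:C%C]) <= Delta_ s.
    rewrite (reindex_inj (@perm_inj _ s)) [X in _ - X](reindex_inj (@perm_inj _ s)) /=.
    apply: (cabs_prodB_le (dl := fun j => delta (s j)) (q := fun j => q (s j))) => j.
    - by rewrite cabsM !cabs_cexpi mulr1.
    - by rewrite QE cabsM cabs_cexpi mul1r; exact: cabs_le_sup_horner.
    - by rewrite QE -mulrBr cabsM cabs_cexpi mul1r; exact: cabs_le_sup_cexpiB.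
  by apply: le_bigmin => // s _.
have mdk : cmeasurable dk.
  rewrite (_ : dk = fun xy => k xy + -1 * k' xy); last first.
    by apply/funext => xy; rewrite mulN1r.
  by apply: cmeasurableD => //; apply: cmeasurableM => //; exact: cmeasurable_cst.
have sdk : square_integrable (mu \x nu)%E dk by exact: (ae_le_square_integrable sA mdk dkA).
have sk' : square_integrable (mu \x nu)%E k'.
  rewrite (_ : k' = fun xy => -1 * dk xy + k xy); first exact: square_integrable_lin.
  by apply/funext => xy; rewrite /dk mulN1r opprB subrK.
have KE : K = kernel_op nu k.
  apply/funext => u; apply/esym; rewrite /K /interaction_op.
  have -> : (fun y => wY y * cintegral mu (fun x => wX x * amplitude a b x y *
      cexpi (phi x + psi y + \sum_l Xs l x * Ys l y) * u x)) =
      (fun y => wY y * kernel_fun mu kE u y) by [].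
  have sf := kernel_fun_square_integrable u sk.
  have mg : cmeasurable (fun y => wY y * kernel_fun mu kE u y).
    by apply: cmeasurableM => //; apply: cmeasurable_kernel_fun => //; exact: L2_cmeasurable.
  have fg : \forall y \ae nu, kernel_fun mu k u y = wY y * kernel_fun mu kE u y.
    apply: filterS (slice_square_integrable sk) => y sy.
    have ik := cintegrableM sy (L2_square_integrable u).
    have kkE x : k (x, y) * u x = wY y * (kE (x, y) * u x) by rewrite /k mulrA.
    (* Where [wY y = 0] both sides vanish, whether or not the slice of [kE] is integrable; elsewhere
       that slice is a multiple of the integrable one of [k]. *)
    rewrite /kernel_fun; have [w0|w0] := eqVneq (wY y) 0.
      rewrite (_ : (fun x => k (x, y) * u x) = fun=> 0).
        by rewrite cintegral0 w0 mul0r.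
      by apply/funext => x; rewrite kkE w0 mul0r.
    rewrite (_ : (fun x => kE (x, y) * u x) = fun x => (wY y)^-1 * (k (x, y) * u x)).
      by rewrite cintegralZ // mulVKf.
    by apply/funext => x; rewrite kkE mulKf.
  apply: eq_toL2 => //; apply: (@ae_le_square_integrable _ _ _ _ 1 _ _ sf mg).
  by apply: filterS fg => y ->; rewrite mul1r.
(* Keeping the error kernel [w] lets the norm bounds and the spectral count be drawn from the same
   approximant. *)
pose good (e : \bar R) := exists (K' : {linear L2 mu -> L2 nu}) (w : X * Y -> R[i]),
  [/\ (oprank K' <= d)%E, (K \- K')%R = kernel_op nu w,
      square_integrable (mu \x nu)%E w & (L2norm (mu \x nu)%E w <= e)%E].
have goodP e : good e -> exists K' : {linear L2 mu -> L2 nu},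
    [/\ (oprank K' <= d)%E, (opnorm (K \- K')%R <= HSnorm (K \- K')%R)%E &
        (HSnorm (K \- K')%R <= e)%E].
  move=> [K' [w [rK' KK' sw we]]]; exists K'; rewrite KK'; split=> //.
    have [L LE] := linear_fun_exists (kernel_op_linear sw).
    by apply: opnorm_le_HSnorm => t u; rewrite -LE linearZ.
  exact: le_trans (HSnorm_kernel_op sw) we.
have good_Delta : good (C * Delta%:E)%E.
  have [K' K'E] := linear_fun_exists (kernel_op_linear sk').
  exists K', dk; rewrite K'E; split=> //.
  - rewrite k'E; apply: (oprank_separated_kernel (P := I0)) => // i iI0.
      by exists i.1, (fun l => i.2 l : nat); split=> // l; exact: (forallP iI0 l).
    by exists i.1, (fun l => i.2 l : nat); split=> // l; exact: (forallP iI0 l).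
  - by apply/funext => u; rewrite /= KE kernel_opB.
  - by rewrite muleC; exact: ae_le_L2norm.
have good_err : good err.
  (* When 1 is the smaller bound the zero operator serves: its error kernel is [k], of modulus
     [cabs (A xy)], hence of norm at most [C]. *)
  rewrite /err; have [le1|lt1] := leP 1 (\prod_l (1 + delta l) - 1).
    have [K' K'E] := @linear_fun_exists _ (L2 mu) (L2 nu) (fun=> 0)
      (fun c u v => esym (etrans (addr0 _) (scaler0 _ c))).
    exists K', k; rewrite K'E; split=> //.
    - by rewrite oprank0 le_min !ldim_ge0.
    - by apply/funext => u; rewrite /= KE subr0.
    - have := @ae_le_L2norm _ _ _ (mu \x nu)%E 1 A k ler01 mA mk.
      rewrite mule1 mul1e; apply; apply: aeW => xy; by rewrite cabsk mul1r.
  have [K' [w [rK' KK' sw we]]] := good_Delta; exists K', w; split=> //.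
  apply: (le_trans we); apply: lee_wpmul2l; first exact: Lnorm_ge0.
  by rewrite lee_fin.
split; [exact: goodP|exact: qle|exact: DeltaE|exact: goodP|].
move=> eps _ /andP[eps0 _] err_eps; split.
  have [K' [w [rK' KK' sw we]]] := good_err.
  apply: le_trans rK'; apply: (Lambda_le_oprank (K := K)).
  - by move=> t u v; rewrite linearP.
  - exact: Re_inner_adjoint_le.
  (* On the kernel of [K'], [K] agrees with the error operator, whose norm is at most that of [w],
     hence at most [sqrt eps]. *)
  - move=> u K'u; have -> : K u = kernel_op nu w u by rewrite -KK' /= K'u subr0.
    rewrite -lee_fin EFinM; apply: (le_trans (sqn_kernel_op u sw)).
    apply: lee_wpmul2r; first by rewrite lee_fin sqn_ge0.
    rewrite -poweR_L2norm.
    have : (L2norm (mu \x nu)%E w `^ 2 <= (Num.sqrt eps)%:E `^ 2)%E.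
      apply: gt0_ler_poweR; rewrite ?in_itv /= ?leey ?andbT ?Lnorm_ge0 ?lee_fin ?sqrtr_ge0 //.
      exact: le_trans we err_eps.
    move=> /le_trans; apply.
    by rewrite poweR_EFin powR_mulrn ?sqrtr_ge0 // sqr_sqrtr // ltW.
have cardI0 : #|I0| = (p * \prod_l N l)%N.
  rewrite -(card_multi_indices Nn) -[in RHS](card_ord p) -cardX.
  by apply: eq_card => -[j f].
(* Either dimension bounds [d]; the generators over X are indexed by [I0]. *)
apply: (@le_trans _ _ (ldim (box_space mu N wX a phi0 Xt))); first by rewrite ge_min lexx.
rewrite -cardI0; apply: (ldim_lspan_le (P := I0) (g := fun i => toL2 mu (G i))).
move=> _ [j [e [eN ->]]].
have en l : (e l < n)%N by exact: leq_trans (eN l) (Nn l).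
exists (j, [ffun l => Ordinal (en l)]).
  by apply/familyP => l; rewrite ffunE; exact: eN.
congr toL2; apply/funext => x; rewrite /G /=; congr (_ * (_)%:C%C).
by apply: eq_bigr => l _; rewrite ffunE.
Qed.
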